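(* The minimum net total curvature $\mathrm{NTC}(\{L_m\})$ for graphs of the type of $L_m$, the ladder of $m$ rungs, equals $\pi(2+m)$.
   Context: For an integer $m\ge1$, $L_m$ is the ''ladder of $m$ rungs'': the graph obtained from two unit circles in parallel planes (one directly above the other) by adding $m$ line segments (''rungs'') perpendicular to the planes, each joining one vertex on the first circle to another vertex on the second circle; it has $2m$ vertices, all of degree 3. (For example $L_4$ is the 1-skeleton of the cube.) Mappings $f$ of a finite graph $\Gamma$ into $\mathbb{R}^n$ are piecewise $C^2$: after adding finitely many degree-2 vertices, each edge is mapped as a regular $C^2$ arc up to its endpoints; $f$ need not be an embedding. Net total curvature: at a vertex $q$ of degree $d$ with unit tangent vectors $T_1,\dots,T_d\in S^{n-1}$ pointing into the edges ending at $q$, let $\chi_i:S^{n-1}\to\{\pm1\}$ be $-1$ where $\langle e,T_i\rangle>0$ and $+1$ where $\langle e,T_i\rangle<0$ (a.e.). Set $\mathrm{ntc}(q)=\pi$ times the average over $e\in S^{n-1}$ of $\big[\sum_{i=1}^d\chi_i(e)\big]^+$ (for $n=1$, the average over $S^0=\{\pm1\}$), and $\mathrm{NTC}(f)=\sum_q\mathrm{ntc}(q)+\int|\vec k|\,ds$, the sum over all vertices (including those of degree 2) and the integral of the curvature over the open $C^2$ edges. $\mathrm{NTC}(\{\Gamma\})$ is the infimum of $\mathrm{NTC}(f)$ over all mappings $f:\Gamma\to\mathbb{R}^n$ (all $n$). *)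

(* Defs.v *)
From HB Require Import structures.
From mathcomp Require Import all_boot all_order all_algebra.
From mathcomp Require Import all_classical all_reals all_analysis.

Set Implicit Arguments.
Unset Strict Implicit.
Unset Printing Implicit Defensive.

Import Order.TTheory GRing.Theory Num.Theory.
Import numFieldNormedType.Exports.

Local Open Scope classical_set_scope.
Local Open Scope ring_scope.

Section measure_power.
Context {d} {T : measurableType d} {R : realType}
  (m : {sigma_finite_measure set T -> \bar R}).

Definition tcons n (p : T * n.-tuple T) : n.+1.-tuple T :=
  [the n.+1.-tuple T of p.1 :: p.2].

Definition tuncons n (x : n.+1.-tuple T) : T * n.-tuple T :=
  (thead x, [tuple of behead x]).

Lemma measurable_tcons n : measurable_fun setT (@tcons n).
Proof. exact: measurable_cons. Qed.

Lemma measurable_tuncons n : measurable_fun setT (@tuncons n).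
Proof.
apply: measurable_fun_pair; [exact: measurable_tnth | exact: measurable_behead].
Qed.

Lemma tconsK n : cancel (@tcons n) (@tuncons n).
Proof. by case=> a x; congr pair; apply/val_inj. Qed.

Section step.
Variables (n : nat) (mu : {sigma_finite_measure set (n.-tuple T) -> \bar R}).

Definition measure_powerS : set (n.+1.-tuple T) -> \bar R :=
  pushforward (m \x mu)%E (@tcons n).

Let powerS_measure : {measure set (n.+1.-tuple T) -> \bar R} :=
  measure_function_pushforward__canonical__measure_function_Measure
    (m \x mu)%E (@measurable_tcons n).

HB.instance Definition _ := isMeasure.Build _ _ _ measure_powerS
  (measure0 powerS_measure) (measure_ge0 powerS_measure)
  (@measure_semi_sigma_additive _ _ _ powerS_measure).

Lemma measure_powerS_sigma_finite : sigma_finite setT measure_powerS.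
Proof.
have /sigma_finiteP[F [FT ndF Foo]] := sigma_finiteT m.
have /sigma_finiteP[G [GT ndG Goo]] := sigma_finiteT mu.
have tunconsK : @tuncons n \o @tcons n = id.
  by apply/funext => x /=; exact: tconsK.
exists (fun i => @tuncons n @^-1` (F i `*` G i)).
  apply/esym/seteqP; split=> // x _.
  have [i _ Fi] : (\bigcup_i F i) (tuncons x).1 by rewrite -FT.
  have [j _ Gj] : (\bigcup_i G i) (tuncons x).2 by rewrite -GT.
  exists (maxn i j) => //; split.
    by move: Fi; exact/subsetPset/ndF/leq_maxl.
  by move: Gj; exact/subsetPset/ndG/leq_maxr.
move=> i; have [mF Fi] := Foo i; have [mG Gi] := Goo i.
have mFG : measurable (F i `*` G i) by exact: measurableX.
split; first by rewrite -[X in measurable X]setTI; exact: measurable_tuncons.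
rewrite /measure_powerS /pushforward -comp_preimage tunconsK preimage_id.
by rewrite product_measure1E// lte_mul_pinfty// ge0_fin_numE.
Qed.

HB.instance Definition _ := Measure_isSigmaFinite.Build _ _ _
  measure_powerS measure_powerS_sigma_finite.

End step.

(* The product measure on T^n, n.-tuple T having the product
   sigma-algebra. *)
Fixpoint measure_power n : {sigma_finite_measure set (n.-tuple T) -> \bar R} :=
  match n with
  | 0 => \d_([tuple] : 0.-tuple T)
  | n'.+1 => measure_powerS (measure_power n')
  end.

End measure_power.

Definition lebesgue_tuple (R : realType) (n : nat) :=
  measure_power (@lebesgue_measure R) n.

Section euclidean.
Context {R : realType} {n : nat}.

(* The library norm on 'rV[R]_n is the sup norm. *)
Definition dot (u v : 'rV[R]_n) : R := \sum_i u 0 i * v 0 i.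

Definition enorm (u : 'rV[R]_n) : R := Num.sqrt (dot u u).

Definition direction (u : 'rV[R]_n) : 'rV[R]_n := (enorm u)^-1 *: u.

Definition vec_of_tuple (x : n.-tuple (measurableTypeR R)) : 'rV[R]_n :=
  \row_i tnth x i.

Definition unit_ball : set (n.-tuple (measurableTypeR R)) :=
  [set x | enorm (vec_of_tuple x) <= 1].

(* Average over S^(n-1) for the normalized surface measure, which gives to a
   set A of unit vectors the proportion, in the unit ball of R^n, of the cone
   of the x with x/|x| in A. For n = 1 both points of S^0 get weight 1/2. *)
Definition sphere_average (g : 'rV[R]_n -> R) : \bar R :=
  ((fine (lebesgue_tuple R n unit_ball))^-1%:E *
   \int[lebesgue_tuple R n]_(x in unit_ball)
      (g (direction (vec_of_tuple x)))%:E)%E.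

(* chi T e is -1 if <e, T> > 0 and 1 if <e, T> < 0; it is 0 on the null set
   where <e, T> = 0. *)
Definition chi (T e : 'rV[R]_n) : R := - Num.sg (dot e T).

(* ntc of a vertex, given the list of the unit tangent vectors pointing into
   the edges ending there. *)
Definition ntc (Ts : seq 'rV[R]_n) : \bar R :=
  (pi%:E * sphere_average (fun e => Num.max 0 (\sum_(T <- Ts) chi T e))%R)%E.

(* A regular arc parametrized by [0, 1], C^2 up to its endpoints: the
   restriction to [0, 1] of a C^2 map defined on R. *)
Definition regular_C2_arc (c : R -> 'rV[R]_n) : Prop :=
  [/\ forall t, derivable c t 1,
      forall t, derivable (derive1 c) t 1,
      continuous (derive1 (derive1 c)) &
      forall t, 0 <= t <= 1 -> derive1 c t != 0].

Definition unit_tangent (c : R -> 'rV[R]_n) (t : R) : 'rV[R]_n :=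
  direction (derive1 c t).

(* The curvature vector is dT/ds, with ds = |c'(t)| dt. *)
Definition curvature_vector (c : R -> 'rV[R]_n) (t : R) : 'rV[R]_n :=
  (enorm (derive1 c t))^-1 *: derive1 (unit_tangent c) t.

Definition arc_curvature (c : R -> 'rV[R]_n) : \bar R :=
  (\int[@lebesgue_measure R]_(t in `]0%R, 1%R[)
     (enorm (curvature_vector c t) * enorm (derive1 c t))%:E)%E.

End euclidean.

(* Finite graphs, with loops and multiple edges allowed; the orientation of
   the edges is only used for parametrizing them. *)
Record graph := Graph {
  vertex : finType;
  edge : finType;
  src : edge -> vertex;
  tgt : edge -> vertex }.

(* A piecewise C^2 mapping of G into R^n: the edge e is subdivided by
   [breaks e] vertices of degree 2 into the arcs [arc e i], i <= breaks e,
   each parametrized by [0, 1]; the values of [arc] at other indices or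
   parameters are irrelevant. *)
Record mapping (R : realType) (G : graph) (n : nat) := Mapping {
  position : vertex G -> 'rV[R]_n;
  breaks : edge G -> nat;
  arc : edge G -> nat -> R -> 'rV[R]_n;
  arc_regular : forall e i, (i <= breaks e)%N -> regular_C2_arc (arc e i);
  arc_src : forall e, arc e 0%N 0 = position (src e);
  arc_tgt : forall e, arc e (breaks e) 1 = position (tgt e);
  arc_joint : forall e i, (i < breaks e)%N -> arc e i 1 = arc e i.+1 0 }.

Section total_curvature.
Context {R : realType} {G : graph} {n : nat} (f : mapping R G n).

(* A loop at v contributes two tangent vectors. *)
Definition vertex_tangents (v : vertex G) : seq 'rV[R]_n :=
  [seq unit_tangent (arc f e 0%N) 0 | e <- enum (edge G) & src e == v] ++
  [seq - unit_tangent (arc f e (breaks f e)) 1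
     | e <- enum (edge G) & tgt e == v].

Definition joint_tangents (e : edge G) (i : nat) : seq 'rV[R]_n :=
  [:: - unit_tangent (arc f e i) 1; unit_tangent (arc f e i.+1) 0].

Definition NTC : \bar R :=
  (\sum_(v : vertex G) ntc (vertex_tangents v) +
   \sum_(e : edge G) \sum_(i < breaks f e) ntc (joint_tangents e i) +
   \sum_(e : edge G) \sum_(i < (breaks f e).+1) arc_curvature (arc f e i))%E.

End total_curvature.

Definition min_NTC (R : realType) (G : graph) : \bar R :=
  ereal_inf [set x | exists n, exists2 f : mapping R G n,
                       (0 < n)%N & x = NTC f].

(* The vertices (false, i) and (true, i), in cyclic order, lie on the two
   circles; the edges are the circle arcs from (b, i) to (b, i+1 mod m) and
   the rungs from (false, i) to (true, i). For m = 1 the circles are loops. *)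
Definition ladder (m : nat) : graph := {|
  vertex := (bool * 'I_m)%type;
  edge := ((bool * 'I_m) + 'I_m)%type;
  src := fun e => match e with inl p => p | inr i => (false, i) end;
  tgt := fun e =>
    match e with inl p => (p.1, ordS p.2) | inr i => (true, i) end |}.

(* Main.v *)
Require Import Defs.
From mathcomp Require Import all_boot all_order all_algebra.
From mathcomp Require Import all_classical all_reals all_analysis.
From mathcomp Require Import measurable_realfun ring lra.

(** The net total curvature of a vertex is an average over all directions e, so
    everything rests on the pseudometric angle u v, which is pi times the
    proportion of the hyperplanes separating u from v. It satisfies
    angle u (- u) = pi, hence a vertex of degree 2 with tangents - u and v
    contributes its exterior angle angle u v. For a vertex of degree 3 the
    identity 2 |r + s + t| = |r + s| + |s + t| + |t + r| between signs
    (sgr_trivalent) shows that its contribution is half the sum of the exterior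
    angles of the three ways of passing through the vertex (mean_trivalent).

    Lower bound. Draw the ladder as a prism: it has m + 2 faces, two circles and m
    quadrilaterals. Every edge lies on two faces, and at every vertex the three
    passages belong to three different faces. Therefore twice the net total
    curvature of a mapping is the sum of the total curvatures of the m + 2 closed
    curves that bound the faces (NTC_ladder_ge). Each of them is at least 2 pi by
    Fenchel's inequality (fenchel), which gives pi (m + 2).

    Fenchel's inequality is proved by Crofton's method. For a closed curve and
    almost every linear form, the form is positive on some tangents and negative
    on others, so its sign along a fine cyclic sample of tangents changes at least
    twice; average over all forms and use Fatou's lemma. This requires that the
    angle between two tangents of an arc is at most the integral of the curvature
    between them (angle_le_arc_length). By subdivision it is enough to compare the
    angle with the chord for close unit vectors (angle_le_chord), and this follows
    from the invariance of the average under reflections, because k equal steps on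
    a half great circle have total angle at most pi. The invariance of the product
    Lebesgue measure under reflections is derived from its invariance under
    translations (lebesgue_tuple_treflection).

    Equality. A mapping into the line for which every vertex has tangents in both
    directions and exactly two joints are folded has net total curvature
    2 m (pi / 2) + 2 pi (NTC_flat_ladder). *)

Set Implicit Arguments.
Unset Strict Implicit.
Unset Printing Implicit Defensive.

Import Order.TTheory GRing.Theory Num.Theory.
Import numFieldNormedType.Exports.
(* path.arc would otherwise hide the arcs of a mapping. *)
Import Defs.

Local Open Scope classical_set_scope.
Local Open Scope ring_scope.

(** * The Euclidean inner product *)

Section dot.
Context {R : realType} {n : nat}.
Implicit Types (a : R) (u v w : 'rV[R]_n).

Lemma dotC u v : dot u v = dot v u.
Proof. by apply: eq_bigr => i _; rewrite mulrC. Qed.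

Lemma dotDl u v w : dot (u + v) w = dot u w + dot v w.
Proof.
by rewrite -big_split; apply: eq_bigr => i _; rewrite mxE mulrDl.
Qed.

Lemma dotDr u v w : dot u (v + w) = dot u v + dot u w.
Proof. by rewrite !(dotC u) dotDl. Qed.

Lemma dotZl a u v : dot (a *: u) v = a * dot u v.
Proof. by rewrite /dot mulr_sumr; apply: eq_bigr => i _; rewrite mxE mulrA. Qed.

Lemma dotZr a u v : dot u (a *: v) = a * dot u v.
Proof. by rewrite !(dotC u) dotZl. Qed.

Lemma dotNl u v : dot (- u) v = - dot u v.
Proof. by rewrite -scaleN1r dotZl mulN1r. Qed.

Lemma dotNr u v : dot u (- v) = - dot u v.
Proof. by rewrite !(dotC u) dotNl. Qed.

Lemma dot0l u : dot 0 u = 0.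
Proof. by rewrite -(scale0r 0) dotZl mul0r. Qed.

Lemma dot0r u : dot u 0 = 0.
Proof. by rewrite dotC dot0l. Qed.

Definition dotE :=
  (dotDl, dotDr, dotNl, dotNr, dotZl, dotZr, dot0l, dot0r).

Lemma dot_ge0 u : 0 <= dot u u.
Proof. by apply: sumr_ge0 => i _; rewrite -expr2 sqr_ge0. Qed.

Lemma dot_eq0 u : (dot u u == 0) = (u == 0).
Proof.
apply/eqP/eqP => [/eqP|->]; last by rewrite dot0l.
rewrite psumr_eq0; last by move=> i _; rewrite -expr2 sqr_ge0.
move=> /allP u0; apply/rowP => i; rewrite mxE.
by have := u0 i (mem_index_enum _); rewrite mulf_eq0 orbb => /eqP.
Qed.

Lemma enorm_ge0 u : 0 <= enorm u.
Proof. exact: sqrtr_ge0. Qed.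

Lemma sqr_enorm u : enorm u ^+ 2 = dot u u.
Proof. by rewrite sqr_sqrtr ?dot_ge0. Qed.

Lemma enorm_eq0 u : (enorm u == 0) = (u == 0).
Proof. by rewrite -dot_eq0 -sqr_enorm sqrf_eq0. Qed.

Lemma enorm_gt0 u : (0 < enorm u) = (u != 0).
Proof. by rewrite lt_def enorm_ge0 andbT enorm_eq0. Qed.

Lemma enormZ a u : enorm (a *: u) = `|a| * enorm u.
Proof.
by rewrite /enorm !dotE mulrA -expr2 sqrtrM ?sqr_ge0 // sqrtr_sqr.
Qed.

Lemma enormN u : enorm (- u) = enorm u.
Proof. by rewrite /enorm !dotE opprK. Qed.

Lemma enorm1P u : enorm u = 1 <-> dot u u = 1.
Proof.
split=> [u1|u1]; first by rewrite -sqr_enorm u1 expr1n.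
by rewrite /enorm u1 sqrtr1.
Qed.

Lemma enorm_direction u : u != 0 -> enorm (direction u) = 1.
Proof.
move=> u0; rewrite enormZ ger0_norm ?invr_ge0 ?enorm_ge0 //.
by rewrite mulVf // enorm_eq0.
Qed.

Lemma directionK u : enorm u *: direction u = u.
Proof.
have [->|u0] := eqVneq u 0; first by rewrite /direction !scaler0.
by rewrite scalerA divff ?scale1r // enorm_eq0.
Qed.

Lemma cauchy_schwarz u v : dot u v <= enorm u * enorm v.
Proof.
have [->|v0] := eqVneq v 0.
  by rewrite dot0r mulr_ge0 // enorm_ge0.
have [->|u0] := eqVneq u 0.
  by rewrite dot0l mulr_ge0 // enorm_ge0.
have H := dot_ge0 (enorm v *: u - enorm u *: v).
rewrite !dotE (dotC v u) -!sqr_enorm in H.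
have a0 : 0 < enorm u * enorm v by rewrite mulr_gt0 // enorm_gt0.
rewrite -subr_ge0 -(pmulr_rge0 _ a0).
nra.
Qed.

(** The sign functions that enter the net total curvature do not see the
    length of the vector, so averages over the sphere become averages over the
    ball of functions of the undivided vector. *)
Lemma sg_dot_direction u v : Num.sg (dot (direction u) v) = Num.sg (dot u v).
Proof.
have [->|u0] := eqVneq u 0; first by rewrite /direction scaler0.
by rewrite -[in RHS](directionK u) dotZl sgrM [Num.sg (enorm u)]gtr0_sg
  ?mul1r // enorm_gt0.
Qed.

End dot.

Section vec.
Context {R : realType} {n : nat}.
Notation tR := (n.-tuple (measurableTypeR R)).

Definition tuple_of_vec (v : 'rV[R]_n) : tR := [tuple v 0 i | i < n].

Lemma tuple_of_vecK : cancel tuple_of_vec vec_of_tuple.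
Proof. by move=> v; apply/rowP => i; rewrite mxE tnth_mktuple. Qed.

Lemma vec_of_tupleK : cancel vec_of_tuple tuple_of_vec.
Proof.
by move=> x; apply: eq_from_tnth => i; rewrite tnth_mktuple mxE.
Qed.

Lemma measurable_vec d (T : measurableType d) (f : T -> tR) (i : 'I_n) :
  measurable_fun setT f ->
  measurable_fun setT (fun x => vec_of_tuple (f x) 0 i : measurableTypeR R).
Proof.
move=> mf; rewrite [X in measurable_fun _ X](_ : _ = (fun t => tnth t i) \o f).
  exact: measurableT_comp (measurable_tnth i) mf.
by apply/funext => x /=; rewrite mxE.
Qed.

Lemma measurable_tuple_of_vec d (T : measurableType d) (f : T -> 'rV[R]_n) :
  (forall i, measurable_fun setT (fun x => f x 0 i : measurableTypeR R)) ->
  measurable_fun setT (fun x => tuple_of_vec (f x)).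
Proof.
move=> mf; apply/measurable_fun_tnthP => i.
rewrite [X in measurable_fun _ X](_ : _ = fun x => f x 0 i) //.
by apply/funext => x /=; rewrite tnth_mktuple.
Qed.

Lemma measurable_dot d (T : measurableType d) (f g : T -> 'rV[R]_n) :
  (forall i, measurable_fun setT (fun x => f x 0 i : measurableTypeR R)) ->
  (forall i, measurable_fun setT (fun x => g x 0 i : measurableTypeR R)) ->
  measurable_fun setT (fun x => dot (f x) (g x) : measurableTypeR R).
Proof.
move=> mf mg; apply: measurable_sum => i.
exact: (measurable_funM (mf i) (mg i)).
Qed.

End vec.

(** * Translation invariance of Lebesgue measure on tuples *)

Section translation.
Context {R : realType}.
Notation lam := (@lebesgue_measure R).
Notation mR := (measurableTypeR R).

Lemma ge0_integral_lebesgue_translate (f : mR -> \bar R) (c : R) :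
  measurable_fun setT f -> (forall x, 0 <= f x)%E ->
  (\int[lam]_x f (x + c)%R = \int[lam]_x f x)%E.
Proof.
move=> mf f0.
have mc : measurable_fun setT ((fun x => x + c) : mR -> mR).
  exact: measurable_funD.
pose nu := pushforward lam ((fun x => x + c) : mR -> mR).
rewrite [RHS](@eq_measure_integral _ _ _ _ nu).
  by rewrite ge0_integral_pushforward.
move=> A mA _; rewrite /nu; apply: lebesgue_measure_unique => //= _ [[a b]] _ <-.
rewrite /pushforward.
rewrite (_ : _ @^-1` _ = `]a - c, b - c]%classic).
  by rewrite !lebesgue_measure_itv /= !lte_fin ltrD2r -!EFinB; congr (if _ then _%:E else _); ring.
by apply/seteqP; split=> x /=; rewrite !in_itv /= ltrBlDr lerBrDr.
Qed.

End translation.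

Section lebesgue_tuple.
Context {R : realType}.
Notation mR := (measurableTypeR R).
Notation lam := (@lebesgue_measure R).
Notation mu n := (lebesgue_tuple R n).

(** Slicing by the head of the tuple is the induction step of every statement
    below on the product measure. *)
Lemma lebesgue_tupleS n (A : set (n.+1.-tuple mR)) :
  mu n.+1 A = (\int[lam]_a mu n [set b | A (tcons (a, b))])%E.
Proof.
rewrite /lebesgue_tuple /= /measure_powerS /pushforward /product_measure1.
apply: eq_integral => a _ /=; congr (_ _); rewrite /xsection.
by apply/seteqP; split => b /=; rewrite ?inE.
Qed.

Lemma measurable_fun_section n (A : set (n.+1.-tuple mR)) : measurable A ->
  measurable_fun setT (fun a : mR => mu n [set b | A (tcons (a, b))]).
Proof.
move=> mA.
have mB : measurable ((@tcons _ mR n) @^-1` A).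
  by rewrite -[X in measurable X]setTI; exact: measurable_tcons.
rewrite [X in measurable_fun _ X](_ : _ = mu n \o xsection ((@tcons _ mR n) @^-1` A)).
  exact: measurable_fun_xsection.
by apply/funext => a /=; congr (_ _); rewrite /xsection; apply/seteqP; split => b /=; rewrite ?inE.
Qed.

Lemma measurable_section n (A : set (n.+1.-tuple mR)) (a : mR) : measurable A ->
  measurable [set b | A (tcons (a, b))].
Proof.
move=> mA; rewrite -[X in measurable X]setTI.
have := @measurable_cons _ _ _ mR (cst a) n id; rewrite /=.
move=> /(_ (measurable_cst _) (@measurable_id _ _ _)) m; exact: m.
Qed.

Definition tadd n (x y : n.-tuple mR) : n.-tuple mR :=
  tuple_of_vec (vec_of_tuple x + vec_of_tuple y).

Lemma tadd_tcons n (a b : mR) (x y : n.-tuple mR) :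
  tadd (tcons (a, x)) (tcons (b, y)) = tcons (a + b, tadd x y).
Proof.
apply: eq_from_tnth => i; rewrite tnth_mktuple !mxE.
case: (unliftP ord0 i) => [j ->|->]; last by rewrite !tnth0.
by rewrite !tnthS tnth_mktuple !mxE.
Qed.

Lemma lebesgue_tuple_translate n (y : n.-tuple mR) (A : set (n.-tuple mR)) :
  measurable A -> mu n [set x | A (tadd x y)] = mu n A.
Proof.
elim: n y A => [|n IH] y A mA.
  congr (_ _); apply/funext => x /=; congr A.
  by apply: eq_from_tnth => -[].
rewrite !lebesgue_tupleS.
have -> : y = tcons (thead y, [tuple of behead y]).
  by rewrite [LHS](tuple_eta y); apply: val_inj.
rewrite -[RHS](ge0_integral_lebesgue_translate (thead y)) //; last first.
  exact: measurable_fun_section.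
apply: eq_integral => a _.
rewrite -[RHS](IH [tuple of behead y]); last first.
  exact: measurable_section.
congr (_ _); apply/funext => b; congr A; exact: tadd_tcons.
Qed.

End lebesgue_tuple.

(** * The unit ball and hyperplanes *)

Section sections.
Context d1 d2 (T1 : measurableType d1) (T2 : measurableType d2) (R : realType).
Variables (m1 : {sigma_finite_measure set T1 -> \bar R})
  (m2 : {sigma_finite_measure set T2 -> \bar R}).

Lemma tonelli_sections (S : set (T1 * T2)) : measurable S ->
  (\int[m1]_x m2 [set y | S (x, y)] = \int[m2]_y m1 [set x | S (x, y)])%E.
Proof.
move=> mS.
transitivity (\int[m1]_x fubini_F m2 (EFin \o \1_S) x)%E.
  apply: eq_integral => x _; rewrite (indic_fubini_tonelli_FE m2 mS) /=.
  by congr (m2 _); apply/seteqP; split => y; rewrite /xsection /= inE.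
rewrite indic_fubini_tonelli //.
apply: eq_integral => y _; rewrite (indic_fubini_tonelli_GE m1 mS) /=.
by congr (m1 _); apply/seteqP; split => x; rewrite /ysection /= inE.
Qed.

End sections.

Section ball.
Context {R : realType}.
Notation mR := (measurableTypeR R).
Notation lam := (@lebesgue_measure R).
Notation mu n := (lebesgue_tuple R n).
Notation vec := vec_of_tuple.
Notation ball n := (@unit_ball R n).

Definition cube n (a b : R) : set (n.-tuple mR) :=
  [set x | forall i, a <= tnth x i <= b].
Arguments cube : clear implicits.

Lemma measurable_cube n a b : measurable (cube n a b).
Proof.
rewrite (_ : cube n a b = \bigcap_(i in [set: 'I_n]) [set x | a <= tnth x i <= b]).
  apply: fin_bigcap_measurable; first exact: finite_finset.
  move=> i _; rewrite (_ : [set x | _] = (fun x => tnth x i) @^-1` `[a, b]).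
    by rewrite -[X in measurable X]setTI; apply: measurable_tnth.
  by apply/seteqP; split=> x /=; rewrite in_itv.
by apply/seteqP; split => [x h i _|x h i]; exact: h.
Qed.

Lemma lebesgue_tuple_cube n (a b : R) : a <= b ->
  mu n (cube n a b) = ((b - a) ^+ n)%:E.
Proof.
move=> ab; elim: n => [|n IH].
  rewrite (_ : cube 0 a b = setT); first by rewrite /lebesgue_tuple /= diracT.
  by apply/seteqP; split => // x _ [].
rewrite lebesgue_tupleS.
transitivity (\int[lam]_x (((b - a) ^+ n)%:E * (\1_`[a, b] x)%:E))%E; last first.
  rewrite ge0_integralZl //=; last 2 first.
  - exact/measurable_EFinP/measurable_indic.
  - by rewrite lee_fin exprn_ge0 // subr_ge0.
  rewrite integral_indic //= setIT lebesgue_measure_itv /= lte_fin.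
  case: ltgtP ab => // [ab _|-> _]; first by rewrite -EFinD -EFinM exprSr.
  by rewrite mule0 subrr expr0n.
apply: eq_integral => x _; rewrite indicE.
have [xab|xab] := boolP (a <= x <= b).
  rewrite mem_set /= ?in_itv // mule1 -IH; congr (mu n _); apply/seteqP; split => y /= h i.
    by have := h (lift ord0 i); rewrite tnthS.
  by case: (unliftP ord0 i) => [j ->|->]; rewrite ?tnthS ?tnth0.
rewrite memNset /= ?in_itv; last exact/negP.
rewrite mule0 [X in mu n X](_ : _ = set0) ?measure0 //.
apply/seteqP; split=> // y /= h; case/negP: xab.
by have := h ord0; rewrite tnth0.
Qed.

Lemma measurable_dotl n (u : 'rV[R]_n) :
  measurable_fun setT (fun x : n.-tuple mR => dot (vec x) u : mR).
Proof.
apply: measurable_dot => i; first exact: measurable_vec.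
exact: measurable_cst.
Qed.

Lemma unit_ballE n (x : n.-tuple mR) : ball n x <-> dot (vec x) (vec x) <= 1.
Proof.
rewrite /unit_ball /= /enorm -{1}(@sqrtr1 R).
by rewrite ler_psqrt // nnegrE ?dot_ge0 ?ler01.
Qed.

Lemma measurable_unit_ball n : measurable (ball n).
Proof.
pose f (x : n.-tuple mR) : mR := dot (vec x) (vec x).
have mf : measurable_fun setT f.
  by apply: measurable_dot => i; exact: measurable_vec.
rewrite (_ : ball n = f @^-1` `]-oo, 1]).
  by rewrite -[X in measurable X]setTI; apply: mf.
by apply/seteqP; split=> x; rewrite unit_ballE /= in_itv.
Qed.

Lemma unit_ball_fin n : (mu n (ball n) < +oo)%E.
Proof.
apply: (@le_lt_trans _ _ (mu n (cube n (-1) 1))); last first.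
  by rewrite lebesgue_tuple_cube ?ltry // lerN10.
apply: le_measure; rewrite ?inE; [exact: measurable_unit_ball|exact: measurable_cube|].
move=> x /unit_ballE x1 i; rewrite -ler_norml -(@expr_le1 _ 2) // real_normK ?num_real //.
apply: le_trans x1; rewrite /dot (bigD1 i) //= mxE -expr2 lerDl.
by apply: sumr_ge0 => j _; rewrite -expr2 sqr_ge0.
Qed.

(** A small cube fits in the ball: with half-side 1/(n+1), the n squared
    coordinates sum to less than 1. *)
Lemma unit_ball_gt0 n : (0 < mu n (ball n))%E.
Proof.
pose c : R := n.+1%:R^-1.
have c0 : 0 < c by rewrite invr_gt0 ltr0n.
apply: (@lt_le_trans _ _ (mu n (cube n (- c) c))).
  by rewrite lebesgue_tuple_cube ?lte_fin ?exprn_gt0 //; lra.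
apply: le_measure; rewrite ?inE; [exact: measurable_cube|exact: measurable_unit_ball|].
move=> x xc; apply/unit_ballE.
apply: (@le_trans _ _ (\sum_(i < n) c)).
  apply: ler_sum => i _; rewrite mxE -expr2 -real_normK ?num_real //.
  have := xc i; rewrite -ler_norml => xi.
  have c1 : c <= 1 by rewrite invf_le1 ?ltr0n // ler1n.
  by have := normr_ge0 (tnth x i); nra.
rewrite sumr_const card_ord -mulr_natl /c ler_pdivrMr ?ltr0n //.
by rewrite mul1r ler_nat.
Qed.

Lemma measurable_dot_eq n (u : 'rV[R]_n) (c : R) :
  measurable [set x : n.-tuple mR | dot (vec x) u = c].
Proof.
rewrite (_ : [set x | _] = (fun x => dot (vec x) u : mR) @^-1` [set c]) //.
by rewrite -[X in measurable X]setTI; apply: measurable_dotl.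
Qed.

(** Slice by the first coordinate. If the other coordinates of u do not all
    vanish, every slice is again a hyperplane; if they do, only one slice is
    not empty. *)
Lemma hyperplane_null n (u : 'rV[R]_n) (c : R) : u != 0 ->
  mu n [set x | dot (vec x) u = c] = 0%E.
Proof.
elim: n u c => [|n IH] u c u0.
  by case/eqP: u0; apply/rowP => -[].
pose u' := \row_i u 0 (lift ord0 i).
have dE a b : dot (vec (tcons (a, b))) u = a * u 0 0 + dot (vec b) u'.
  rewrite /dot big_ord_recl !mxE tnth0; congr (_ + _).
  by apply: eq_bigr => i _; rewrite !mxE tnthS.
have mS := measurable_dot_eq u c.
rewrite lebesgue_tupleS.
have [u'0|u'0] := eqVneq u' 0; last first.
  rewrite (eq_integral (cst 0%E)) ?integral0 // => a _ /=.
  rewrite -(IH u' (c - a * u 0 0) u'0); congr (mu n _).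
  apply/seteqP; split=> b /=; rewrite dE; first by move=> <-; ring.
  by move=> ->; ring.
have u00 : u 0 0 != 0.
  apply: contra u0 => /eqP u00; apply/eqP/rowP => i; rewrite mxE.
  case: (unliftP ord0 i) => [j ->|->] //.
  by move/rowP: u'0 => /(_ j); rewrite !mxE.
rewrite (@ge0_negligible_integral _ mR R lam setT [set c / u 0 0]) //; last 2 first.
  exact: measurable_fun_section.
  exact: lebesgue_measure_set1.
rewrite (eq_integral (cst 0%E)) ?integral0 // => a.
rewrite inE /= => -[_ /eqP ac].
rewrite [X in mu n X](_ : _ = set0) ?measure0 //.
apply/seteqP; split=> // b /=; rewrite dE u'0 dot0r addr0 => ac'.
by case/negP: ac; rewrite -ac' mulfK.
Qed.

End ball.

(** * Invariance of Lebesgue measure under axis reflections *)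

Section reflection.
Context {R : realType} {n : nat}.
Notation mR := (measurableTypeR R).
Notation mu := (lebesgue_tuple R n).
Notation vec := vec_of_tuple.
Notation ball := (@unit_ball R n).
Variable p : 'rV[R]_n.

(** For a unit vector p this is the half-turn around the axis of p, and for
    p = 0 it is the antipodal map. Both are linear involutive isometries, and
    the hypothesis dot p p *: p = p covers them at once. *)
Definition axis_reflection (v : 'rV[R]_n) : 'rV[R]_n := (2 * dot v p) *: p - v.

Hypothesis p_axis : dot p p *: p = p.

Notation Q := axis_reflection.

Lemma axis_reflectionK : involutive Q.
Proof.
move=> v; apply/rowP => i; have /rowP/(_ i) := p_axis; rewrite /Q !mxE => pi.
rewrite !dotE.
have -> : 2 * (2 * dot v p * dot p p - dot v p) * p 0 i -
    (2 * dot v p * p 0 i - v 0 i) =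
  4 * dot v p * (dot p p * p 0 i) - 4 * dot v p * p 0 i + v 0 i by ring.
by rewrite pi subrr add0r.
Qed.

Lemma axis_reflectionD u v : Q (u + v) = Q u + Q v.
Proof. by rewrite /Q dotDl mulrDr scalerDl opprD addrACA. Qed.

Lemma axis_reflectionN v : Q (- v) = - Q v.
Proof. by rewrite /Q dotNl mulrN scaleNr opprB opprK addrC. Qed.

Lemma dot_axis_reflection u v : dot (Q u) (Q v) = dot u v.
Proof.
rewrite /Q !dotE (dotC p v).
have E : dot p p * dot u p = dot u p.
  by rewrite -dotZr p_axis.
transitivity (dot u v + 4 * dot v p * (dot p p * dot u p - dot u p)); first by ring.
by rewrite E subrr mulr0 addr0.
Qed.

(** Applying Q to u - Q v gives Q u - v, so this set of pairs is symmetric; it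
    makes both Tonelli integrals below computable. *)
Lemma dot_sub_axis_reflection u v :
  dot (u - Q v) (u - Q v) = dot (v - Q u) (v - Q u).
Proof.
rewrite -dot_axis_reflection axis_reflectionD axis_reflectionN axis_reflectionK.
by rewrite -(opprB v) dotNl dotNr opprK.
Qed.

Definition treflection (x : n.-tuple mR) : n.-tuple mR := tuple_of_vec (Q (vec x)).

Notation tQ := treflection.

Lemma measurable_treflection : measurable_fun setT tQ.
Proof.
apply: measurable_tuple_of_vec => i.
under eq_fun do rewrite /Q !mxE.
apply: measurable_funB; last exact: measurable_tnth.
apply: measurable_funM; last exact: measurable_cst.
apply: measurable_funM; first exact: measurable_cst.
exact: measurable_dotl.
Qed.

Lemma unit_ball_treflection x : ball (tQ x) <-> ball x.
Proof. by rewrite !unit_ballE tuple_of_vecK dot_axis_reflection. Qed.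

Definition tsub (x y : n.-tuple mR) : n.-tuple mR := tuple_of_vec (vec x - vec y).

Lemma measurable_tsub_treflection d (T : measurableType d) (f g : T -> n.-tuple mR) :
  measurable_fun setT f -> measurable_fun setT g ->
  measurable_fun setT (fun z => tsub (f z) (tQ (g z))).
Proof.
move=> mf mg; apply: measurable_tuple_of_vec => i.
under eq_fun do rewrite !mxE.
apply: measurable_funB.
  exact: (measurableT_comp (measurable_tnth i) mf).
apply: (measurableT_comp (measurable_tnth i)).
exact: (measurableT_comp measurable_treflection mg).
Qed.

(** The uniqueness argument for translation-invariant measures, specialized to
    an isometry: the set of the pairs (x, y) with x in A and x - Q y in the unit
    ball B is measured in two ways. For fixed x the condition on y describes a
    translate of B, because Q preserves B, so the measure is mu A * mu B. For
    fixed y, translate x by Q y; then x runs over B and, for fixed x, the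
    condition Q (Q x + y) in A describes a translate of the preimage of A, so
    the measure is mu B * mu (Q^-1 A). It remains to divide by mu B. *)
Lemma lebesgue_tuple_treflection (A : set (n.-tuple mR)) : measurable A ->
  mu (tQ @^-1` A) = mu A.
Proof.
move=> mA.
pose S := [set z : n.-tuple mR * n.-tuple mR | A z.1 /\ ball (tsub z.1 (tQ z.2))].
have mS : measurable S.
  apply: measurableI.
    by rewrite -[X in measurable X]setTI; apply: measurable_fst.
  rewrite -[X in measurable X]setTI.
  apply: (measurable_tsub_treflection measurable_fst measurable_snd) => //.
  exact: measurable_unit_ball.
have mQA : measurable (tQ @^-1` A).
  by rewrite -[X in measurable X]setTI; apply: measurable_treflection.
have mB := @measurable_unit_ball R n.
have Bfin : mu ball \is a fin_num.
  by rewrite ge0_fin_numE ?unit_ball_fin.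
have B0 := @unit_ball_gt0 R n.
have := tonelli_sections mu mu mS.
have -> : (\int[mu]_x mu [set y | S (x, y)] = mu A * mu ball)%E.
  transitivity (\int[mu]_x ((\1_A x)%:E * mu ball))%E; last first.
    rewrite ge0_integralZr //=.
      by rewrite integral_indic // setIT.
    exact/measurable_EFinP/measurable_indic.
  apply: eq_integral => x _; rewrite indicE /S /=.
  have [Ax|Ax] := pselect (A x); last first.
    rewrite memNset // mul0e [X in mu X](_ : _ = set0) ?measure0 //.
    by apply/seteqP; split=> // y [].
  rewrite mem_set // mul1e -[RHS](lebesgue_tuple_translate (tuple_of_vec (- Q (vec x)))) //.
  congr (mu _); apply/seteqP; split=> y /=;
    rewrite !unit_ballE /tadd /tsub /tQ !tuple_of_vecK dot_sub_axis_reflection.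
    by move=> [].
  by [].
have -> : (\int[mu]_y mu [set x | S (x, y)] = mu ball * mu (tQ @^-1` A))%E.
  transitivity (\int[mu]_y mu [set x | A (tadd x (tQ y)) /\ ball x])%E.
    apply: eq_integral => y _.
    rewrite -(lebesgue_tuple_translate (tQ y)); last first.
    by have := measurable_ysection y mS; congr measurable;
      apply/seteqP; split => x; rewrite /ysection /= inE.
  
    congr (mu _); apply/funext => x; rewrite /S /=; congr (_ /\ ball _).
    by rewrite /tsub /tadd tuple_of_vecK addrK vec_of_tupleK.
  pose S2 := [set z : n.-tuple mR * n.-tuple mR | A (tadd z.1 (tQ z.2)) /\ ball z.1].
  have mS2 : measurable S2.
    apply: measurableI.
      rewrite -[X in measurable X]setTI.
      have : measurable_fun setT (fun z => tadd z.1 (tQ z.2) : n.-tuple mR).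
        apply: measurable_tuple_of_vec => i.
        under eq_fun do rewrite !mxE.
        apply: measurable_funD.
          exact: (measurableT_comp (measurable_tnth i) measurable_fst).
        apply: (measurableT_comp (measurable_tnth i)).
        exact: (measurableT_comp measurable_treflection measurable_snd).
      exact.
    by rewrite -[X in measurable X]setTI; apply: measurable_fst.
  rewrite -(tonelli_sections mu mu mS2).
  transitivity (\int[mu]_x ((\1_ball x)%:E * mu (tQ @^-1` A)))%E; last first.
    rewrite ge0_integralZr //=.
      by rewrite integral_indic // setIT.
    exact/measurable_EFinP/measurable_indic.
  apply: eq_integral => x _; rewrite indicE /S2 /=.
  have [Bx|Bx] := pselect (ball x); last first.
    rewrite memNset // mul0e [X in mu X](_ : _ = set0) ?measure0 //.
    by apply/seteqP; split=> // y [].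
  rewrite mem_set // mul1e -[RHS](lebesgue_tuple_translate (tQ x)) //.
  congr (mu _); apply/seteqP; split=> y /=;
    rewrite /tadd /tQ !tuple_of_vecK axis_reflectionD axis_reflectionK addrC.
    by move=> [].
  by [].
rewrite muleC => /eqP E.
apply/eqP; rewrite eq_le -(lee_pmul2l Bfin B0) -[X in _ && X](lee_pmul2l Bfin B0).
by rewrite (eqP E) lexx.
Qed.

End reflection.

(** * Averages over the unit ball *)

Section mean.
Context {R : realType} {n : nat}.
Notation mR := (measurableTypeR R).
Notation mu := (lebesgue_tuple R n).
Notation vec := vec_of_tuple.
Notation ball := (@unit_ball R n).
Notation tR := (n.-tuple mR).
Implicit Types (f g : tR -> R) (u v : 'rV[R]_n).

(** Every function averaged below is built from signs of linear forms; bounded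
    measurable functions are integrable on the ball and closed under the
    operations in use, which spares all integrability conditions. *)
Definition bounded_mfun f := measurable_fun setT f /\ exists M, forall x, `|f x| <= M.

Lemma bounded_mfun_cst c : bounded_mfun (fun=> c).
Proof. by split; [exact: measurable_cst|exists `|c|]. Qed.

Lemma bounded_mfunD f g : bounded_mfun f -> bounded_mfun g -> bounded_mfun (fun x => f x + g x).
Proof.
move=> [mf [M fM]] [mg [N gN]]; split; first exact: measurable_funD.
by exists (M + N) => x; apply: le_trans (ler_normD _ _) _; exact: lerD.
Qed.

Lemma bounded_mfunM f g : bounded_mfun f -> bounded_mfun g -> bounded_mfun (fun x => f x * g x).
Proof.
move=> [mf [M fM]] [mg [N gN]]; split; first exact: (measurable_funM mf mg).
by exists (M * N) => x; rewrite normrM; apply: ler_pM.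
Qed.

Lemma bounded_mfunZ c f : bounded_mfun f -> bounded_mfun (fun x => c * f x).
Proof. by move=> bf; apply: bounded_mfunM => //; exact: bounded_mfun_cst. Qed.

Lemma bounded_mfunN f : bounded_mfun f -> bounded_mfun (fun x => - f x).
Proof.
move=> /(bounded_mfunZ (-1)); congr bounded_mfun; apply/funext => x; exact: mulN1r.
Qed.

Lemma bounded_mfunB f g : bounded_mfun f -> bounded_mfun g -> bounded_mfun (fun x => f x - g x).
Proof. by move=> bf bg; apply: bounded_mfunD => //; exact: bounded_mfunN. Qed.

Lemma bounded_mfun_norm f : bounded_mfun f -> bounded_mfun (fun x => `|f x|).
Proof.
move=> [mf [M fM]]; split; first exact: (measurableT_comp (@normr_measurable R setT) mf).
by exists M => x; rewrite normr_id.
Qed.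

Lemma bounded_mfun_sum (I : Type) (s : seq I) (F : I -> tR -> R) :
  (forall i, bounded_mfun (F i)) -> bounded_mfun (fun x => \sum_(i <- s) F i x).
Proof.
move=> bF; elim: s => [|i s IH].
  under eq_fun do rewrite big_nil; exact: bounded_mfun_cst.
by under eq_fun do rewrite big_cons; exact: bounded_mfunD.
Qed.

Lemma bounded_mfun_sg u : bounded_mfun (fun x => Num.sg (dot (vec x) u)).
Proof.
split; last first.
  by exists 1 => x; rewrite normr_sg; case: (_ == _); rewrite ?lexx ?ler01.
apply: (measurableT_comp _ (measurable_dotl u)).
apply: nondecreasing_measurable => // x y.
by case: (sgrP x); case: (sgrP y) => *; lra.
Qed.

Lemma bounded_mfun_integrable f : bounded_mfun f -> mu.-integrable ball (EFin \o f).
Proof.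
move=> [mf [M fM]]; apply: measurable_bounded_integrable.
- exact: measurable_unit_ball.
- exact: unit_ball_fin.
- exact: measurable_funTS.
- exists M; split; first exact: num_real.
  by move=> N MN x _; exact: le_trans (fM x) (ltW MN).
Qed.

Definition mean f : R := (fine (mu ball))^-1 * \int[mu]_(x in ball) f x.

Lemma vol_gt0 : 0 < fine (mu ball).
Proof. by rewrite fine_gt0 // unit_ball_gt0 unit_ball_fin. Qed.

(** The sphere average of g is the average over the ball of the composition of g
    with the radial projection; f is any more convenient form of it. *)
Lemma sphere_averageE (g : 'rV[R]_n -> R) f : bounded_mfun f ->
  (forall x, g (direction (vec x)) = f x) -> sphere_average g = (mean f)%:E.
Proof.
move=> bf gf; rewrite /sphere_average /mean EFinM; congr (_ * _)%E.
rewrite (eq_integral (EFin \o f)); last by move=> x _; rewrite /= gf.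
rewrite fineK //; apply: integrable_fin_num; first exact: measurable_unit_ball.
exact: bounded_mfun_integrable.
Qed.

Lemma meanD f g : bounded_mfun f -> bounded_mfun g -> mean (fun x => f x + g x) = mean f + mean g.
Proof.
move=> bf bg; rewrite /mean RintegralD ?mulrDr //; try exact: bounded_mfun_integrable.
exact: measurable_unit_ball.
Qed.

Lemma meanZ c f : bounded_mfun f -> mean (fun x => c * f x) = c * mean f.
Proof.
move=> bf; rewrite /mean RintegralZl; [|exact: measurable_unit_ball|exact: bounded_mfun_integrable].
by rewrite mulrCA.
Qed.

Lemma mean_sum (I : Type) (s : seq I) (F : I -> tR -> R) :
  (forall i, bounded_mfun (F i)) -> mean (fun x => \sum_(i <- s) F i x) = \sum_(i <- s) mean (F i).
Proof.
move=> bF; elim: s => [|i s IH].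
  rewrite big_nil -[RHS](mul0r (mean (fun=> 0))) -meanZ; last exact: bounded_mfun_cst.
  by congr mean; apply/funext => x; rewrite big_nil mul0r.
rewrite big_cons -IH -meanD //; last exact: bounded_mfun_sum.
by congr mean; apply/funext => x; rewrite big_cons.
Qed.

Lemma mean_cst c : mean (fun=> c) = c.
Proof.
rewrite /mean Rintegral_cst; last exact: measurable_unit_ball.
by rewrite mulrC mulfK // gt_eqF // vol_gt0.
Qed.

Lemma ler_mean f g : bounded_mfun f -> bounded_mfun g -> (forall x, f x <= g x) -> mean f <= mean g.
Proof.
move=> bf bg fg; rewrite /mean ler_pM2l ?invr_gt0 ?vol_gt0 //.
apply: le_Rintegral; try exact: bounded_mfun_integrable; last by move=> x _; exact: fg.
exact: measurable_unit_ball.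
Qed.

(** Points off finitely many hyperplanes. This is the only form in which
    almost-everywhere statements occur. *)
Definition generic (s : seq 'rV[R]_n) (x : tR) := all (fun u => dot (vec x) u != 0) s.

Lemma generic_null (s : seq 'rV[R]_n) : all (fun u => u != 0) s ->
  exists2 N, measurable N /\ mu N = 0%E & forall x, ~ N x -> generic s x.
Proof.
elim: s => [_|u s IH /= /andP[u0 /IH[N [mN N0] Ns]]].
  by exists set0; [split => //; rewrite measure0|].
exists ([set x | dot (vec x) u = 0] `|` N).
  split; first by apply: measurableU => //; exact: measurable_dot_eq.
  by apply: null_set_setU => //; [exact: measurable_dot_eq|exact: hyperplane_null].
move=> x /= /not_orP[/eqP xu /Ns xs]; exact/andP.
Qed.

Lemma eq_mean_generic (s : seq 'rV[R]_n) f g : bounded_mfun f -> bounded_mfun g ->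
  all (fun u => u != 0) s -> (forall x, generic s x -> f x = g x) -> mean f = mean g.
Proof.
move=> [mf _] [mg _] /generic_null[N [mN N0] Ns] fg; rewrite /mean /Rintegral.
congr (_ * fine _); apply: ae_eq_integral.
- exact: measurable_unit_ball.
- by apply/measurable_EFinP; exact: measurable_funTS.
- by apply/measurable_EFinP; exact: measurable_funTS.
- exists N; split => // x /= h; apply: contrapT => /Ns xs; apply: h => _.
  by rewrite (fg x xs).
Qed.

Lemma mean_treflection p f : dot p p *: p = p -> bounded_mfun f ->
  mean (fun x => f (treflection p x)) = mean f.
Proof.
move=> pp bf; rewrite /mean /Rintegral; congr (_ * fine _).
have mQ := measurable_treflection p.
have QB : treflection p @^-1` ball = ball.
  by apply/seteqP; split=> x /=; rewrite unit_ball_treflection.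
have mB := @measurable_unit_ball R n.
pose nu := pushforward mu (treflection p).
rewrite [RHS](@eq_measure_integral _ _ _ _ nu); last first.
  by move=> A mA _; exact/esym/(lebesgue_tuple_treflection pp mA).
rewrite integral_pushforward //.
- by rewrite QB.
- by apply/measurable_EFinP; apply: measurable_funTS; case: bf.
- rewrite QB; apply: (@bounded_mfun_integrable (fun x => f (treflection p x))).
  case: bf => mf [M fM]; split; first exact: measurableT_comp mf mQ.
  by exists M => x; exact: fM.
Qed.

(** Fatou's lemma, for functions whose lower limit is at least 1 outside
    finitely many hyperplanes. *)
Lemma mean_eventually_ge1 (s : seq 'rV[R]_n) (f : nat -> tR -> R) (C : R) :
  all (fun u => u != 0) s ->
  (forall N, bounded_mfun (f N)) -> (forall N x, 0 <= f N x) ->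
  (forall x, generic s x -> \forall N \near \oo, 1 <= f N x) ->
  (forall N, mean (f N) <= C) -> 1 <= C.
Proof.
move=> s0 bf f0 f1 fC.
have mB := @measurable_unit_ball R n.
have C0 : 0 <= C.
  by apply: le_trans (fC 0%N); rewrite -[X in X <= _](mean_cst 0) ler_mean //;
    exact: bounded_mfun_cst.
have mf N : measurable_fun ball (EFin \o f N).
  by apply/measurable_EFinP; apply: measurable_funTS; case: (bf N).
have F0 N x : ball x -> (0 <= (EFin \o f N) x)%E by rewrite lee_fin.
have := fatou mu mB mf F0.
have -> : (limn_einf (fun N => \int[mu]_(x in ball) (EFin \o f N) x) =
    limn_einf (fun N => (mean (f N) * fine (mu ball))%:E))%E.
  congr limn_einf; apply/funext => N.
  rewrite /mean mulrAC mulVf ?gt_eqF ?vol_gt0 // mul1r fineK //.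
  exact: integrable_fin_num (bounded_mfun_integrable (bf N)).
move=> H.
have : (mu ball <= (C * fine (mu ball))%:E)%E.
  apply: le_trans (le_trans _ H) _; last first.
    rewrite limn_einf_lim; apply: lime_le; first exact: is_cvg_einfs.
    apply: nearW => N; apply: (@le_trans _ _ (mean (f N) * fine (mu ball))%:E).
      by apply: ereal_inf_lbound; exists N => /=.
    by rewrite lee_fin ler_pM2r ?vol_gt0.
  have -> : mu ball = (\int[mu]_(x in ball) (cst 1%E x))%E.
    by rewrite integral_cst // mul1e.
  have [N [mN N0] Ns] := generic_null s0.
  apply: ae_ge0_le_integral => //.
  - move=> x _; rewrite limn_einf_lim; apply: lime_ge; first exact: is_cvg_einfs.
    apply: nearW => M; apply: le_ereal_inf_tmp => _ [m _ <-] /=; rewrite lee_fin.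
    exact: f0.
  - apply: (emeasurable_fun_cvg (fun m x => einfs ((fun N => EFin \o f N) ^~ x) m)).
      by move=> m; apply: measurable_fun_einfs.
    by move=> x _; rewrite limn_einf_lim; exact: is_cvg_einfs.
  exists N; split => // x /= h; apply: contrapT => /Ns xs; apply: h => _.
  have [M _ fM] := f1 x xs.
  rewrite limn_einf_lim; apply: lime_ge; first exact: is_cvg_einfs.
  exists M => // k /= Mk; apply: le_ereal_inf_tmp => _ [m /= km <-] /=.
  by rewrite lee_fin; apply: fM => /=; exact: leq_trans km.
rewrite -[X in (X <= _)%E]fineK ?ge0_fin_numE ?unit_ball_fin //.
by rewrite lee_fin -[X in X <= _]mul1r ler_pM2r // vol_gt0.
Qed.

End mean.

(** * The angle as a measure of separating hyperplanes *)

(** A positive combination of s and t has a sign between the signs of s and t;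
    it is strict because a and b do not both vanish. *)
Lemma sgr_between (R : realFieldType) (a b s t : R) : 0 <= a -> 0 <= b -> 0 < a + b ->
  `|Num.sg s - Num.sg t| =
  `|Num.sg s - Num.sg (a * s + b * t)| + `|Num.sg (a * s + b * t) - Num.sg t|.
Proof.
move=> a0 b0 ab.
have posD (x y : R) : 0 < x -> 0 < y -> 0 < a * x + b * y.
  move=> x0 y0; have [a00|a00] := eqVneq a 0.
    by rewrite a00 mul0r add0r mulr_gt0 //; lra.
  have a1 : 0 < a by rewrite lt_def a00.
  by apply: ltr_pwDl; [exact: mulr_gt0|apply: mulr_ge0 => //; exact: ltW].
have zero (c x : R) : 0 <= c -> `|Num.sg x| = `|Num.sg (c * x)| + `|Num.sg (c * x) - Num.sg x|.
  move=> c0; rewrite (sgrM c x); move: c0; rewrite le_eqVlt => /predU1P[<-|c0].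
    by rewrite sgr0 mul0r normr0 !add0r normrN.
  by rewrite (gtr0_sg c0) mul1r subrr normr0 addr0.
have sg1 (x : R) : -1 <= Num.sg x <= 1.
  by case: sgrP => _; apply/andP; split; lra.
have [s0|s0|->] := ltrgt0P s; have [t0|t0|->] := ltrgt0P t; last first.
- by rewrite !mulr0 addr0 sgr0 subr0 !normr0 addr0.
- by rewrite mulr0 add0r sgr0 !sub0r !normrN; exact: zero.
- by rewrite mulr0 add0r sgr0 !sub0r !normrN; exact: zero.
- by rewrite mulr0 addr0 sgr0 !subr0 distrC addrC; exact: zero.
- have := posD _ _ (_ : 0 < - s) (_ : 0 < - t).
  rewrite !oppr_gt0 => /(_ s0 t0); rewrite !mulrN -opprD oppr_gt0 => st.
  by rewrite !ltr0_sg // subrr normr0 addr0.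
- rewrite (ltr0_sg s0) (gtr0_sg t0).
  by have /andP[] := sg1 (a * s + b * t) => *; rewrite !ler0_norm; lra.
- by rewrite mulr0 addr0 sgr0 !subr0 distrC addrC; exact: zero.
- rewrite (gtr0_sg s0) (ltr0_sg t0).
  by have /andP[] := sg1 (a * s + b * t) => *; rewrite !ger0_norm; lra.
- by rewrite !gtr0_sg ?posD // subrr normr0 addr0.
Qed.

Section crofton_angle.
Context {R : realType} {n : nat}.
Notation mR := (measurableTypeR R).
Notation vec := vec_of_tuple.
Notation tR := (n.-tuple mR).
Implicit Types (u v w : 'rV[R]_n) (x : tR).

Definition sgn u x : R := Num.sg (dot (vec x) u).

(** By Crofton's formula in dimension zero this is the angle between u and v:
    pi times the proportion of the hyperplanes that separate them. Only the
    following consequences of that formula are needed: angle is a pseudometric,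
    it is invariant under reflections, and it is at most the chord
    asymptotically. The signs vanish on hyperplanes, which is why half the
    distance of the signs is averaged rather than an indicator. *)
Definition angle u v : R := pi * mean (fun x => `|sgn u x - sgn v x| / 2).

Lemma bounded_mfun_sgn u : bounded_mfun (sgn u).
Proof. exact: bounded_mfun_sg. Qed.

Lemma bounded_mfun_sgn_dist u v : bounded_mfun (fun x => `|sgn u x - sgn v x| / 2).
Proof.
apply: bounded_mfunM; last exact: bounded_mfun_cst.
by apply: bounded_mfun_norm; apply: bounded_mfunB; exact: bounded_mfun_sgn.
Qed.

Lemma sgn_opp u x : sgn (- u) x = - sgn u x.
Proof. by rewrite /sgn dotNr sgrN. Qed.

Lemma sgn_norm_le1 u x : `|sgn u x| <= 1.
Proof. by rewrite /sgn normr_sg; case: (_ == _); rewrite ?ler01. Qed.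

Lemma angle_sym u v : angle u v = angle v u.
Proof. by congr (_ * mean _); apply/funext => x; rewrite distrC. Qed.

Lemma angle_opp u v : angle (- u) (- v) = angle u v.
Proof.
by congr (_ * mean _); apply/funext => x; rewrite !sgn_opp -opprD normrN.
Qed.

Lemma angle_refl u : angle u u = 0.
Proof.
rewrite /angle [X in mean X](_ : _ = fun=> 0) ?mean_cst ?mulr0 //.
by apply/funext => x; rewrite subrr normr0 mul0r.
Qed.

Lemma angle_ge0 u v : 0 <= angle u v.
Proof.
rewrite mulr_ge0 ?pi_ge0 // -(@mean_cst R n 0).
apply: ler_mean => [||x]; [exact: bounded_mfun_cst|exact: bounded_mfun_sgn_dist|].
by rewrite divr_ge0.
Qed.

Lemma angle_triangle v u w : angle u w <= angle u v + angle v w.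
Proof.
rewrite /angle -mulrDr ler_wpM2l ?pi_ge0 //.
rewrite -meanD; try exact: bounded_mfun_sgn_dist.
apply: ler_mean; first exact: bounded_mfun_sgn_dist.
  by apply: bounded_mfunD; exact: bounded_mfun_sgn_dist.
by move=> x; rewrite -mulrDl ler_pM2r // ler_distD.
Qed.

Lemma angle_le_pi u v : angle u v <= pi.
Proof.
rewrite -[leRHS]mulr1 ler_wpM2l ?pi_ge0 // -[leRHS](@mean_cst R n 1).
apply: ler_mean => [||x]; [exact: bounded_mfun_sgn_dist|exact: bounded_mfun_cst|].
rewrite ler_pdivrMr // mul1r.
apply: le_trans (ler_normB _ _) _.
by have := sgn_norm_le1 u x; have := sgn_norm_le1 v x; lra.
Qed.

Lemma angle_axis_reflection p u v : dot p p *: p = p ->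
  angle (axis_reflection p u) (axis_reflection p v) = angle u v.
Proof.
move=> pp; rewrite /angle; congr (_ * _).
rewrite -[RHS](mean_treflection pp (bounded_mfun_sgn_dist u v)).
congr mean; apply/funext => x.
have E w : sgn w (treflection p x) = sgn (axis_reflection p w) x.
  rewrite /sgn tuple_of_vecK -(dot_axis_reflection pp (axis_reflection p _) w).
  by rewrite axis_reflectionK.
by rewrite !E.
Qed.

(** Additivity of the angle along a geodesic: up to its length, w lies on the short arc
    from u to v. *)
Lemma angle_between u v w a b : 0 <= a -> 0 <= b -> 0 < a + b ->
  w = a *: u + b *: v -> angle u v = angle u w + angle w v.
Proof.
move=> a0 b0 ab ->; rewrite /angle -mulrDr; congr (_ * _).
rewrite -meanD; try exact: bounded_mfun_sgn_dist.
congr mean; apply/funext => x; rewrite -mulrDl; congr (_ / _).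
by rewrite /sgn dotDr !dotZr; exact: sgr_between.
Qed.

(** Points c 0, c 1, ..., c k at equal steps t on a half great circle.
    Reflection in c j.+1 exchanges c j and c j.+2, so all consecutive angles
    agree; they add up to the angle from c 0 to c k, which is at most pi. *)
Lemma equidistant_angle u b (t : R) (k : nat) : dot u u = 1 -> dot b b = 1 ->
  dot u b = 0 -> 0 < t -> k%:R * t < pi ->
  k%:R * angle u (cos t *: u + sin t *: b) <= pi.
Proof.
move=> u1 b1 ub t0 kt.
pose c (j : nat) := cos (j%:R * t) *: u + sin (j%:R * t) *: b.
have c1 j : dot (c j) (c j) = 1.
  rewrite -(cos2Dsin2 (j%:R * t)) /c !dotE (dotC b u) u1 b1 ub; ring.
have c0E : c 0%N = u by rewrite /c mul0r cos0 sin0 scale1r scale0r addr0.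
have c1E : c 1%N = cos t *: u + sin t *: b by rewrite /c mul1r.
have cdot i j : dot (c i) (c j) = cos (i%:R * t - j%:R * t).
  by rewrite /c !dotE (dotC b u) u1 b1 ub cosB; ring.
have cS j : axis_reflection (c j.+1) (c j) = c j.+2.
  have -> : axis_reflection (c j.+1) (c j) = (2 * cos t) *: c j.+1 - c j.
    rewrite /axis_reflection cdot -(cosN t) -(addn1 j) natrD.
    by congr ((_ * cos _) *: _ - _); ring.
  apply/rowP => i; rewrite !mxE.
  have -> : j.+2%:R * t = j.+1%:R * t + t by rewrite -addn1 natrD; ring.
  have -> : j%:R * t = j.+1%:R * t - t by rewrite -(addn1 j) natrD; ring.
  by rewrite !cosD !sinD cosN sinN; ring.
have cQ j : axis_reflection (c j.+1) (c j.+1) = c j.+1.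
  by rewrite /axis_reflection c1 mulr1 scaler_nat mulr2n addrK.
have cbetween j : (0 < j < k)%N -> exists a b : R,
    [/\ 0 <= a, 0 <= b, 0 < a + b & c j = a *: c 0%N + b *: c j.+1].
  move=> /andP[j0 jk].
  have jt : j.+1%:R * t < pi.
    by apply: le_lt_trans kt; rewrite ler_pM2r // ler_nat.
  have sj : 0 < sin (j.+1%:R * t).
    by rewrite sin_gt0_pi // jt andbT mulr_gt0 // ltr0n.
  have s1 : 0 < sin t.
    rewrite sin_gt0_pi // t0 /=; apply: le_lt_trans jt.
    by rewrite ler_peMl // ?ler1n // ltW.
  have sj' : 0 < sin (j%:R * t).
    rewrite sin_gt0_pi // mulr_gt0 // ?ltr0n //=; apply: le_lt_trans jt.
    by rewrite ler_pM2r // ler_nat.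
  exists (sin t / sin (j.+1%:R * t)), (sin (j%:R * t) / sin (j.+1%:R * t)).
  split; [by rewrite divr_ge0 // ltW..| by rewrite addr_gt0 // divr_gt0|].
  rewrite c0E; apply/rowP => i; rewrite !mxE.
  have : sin t = sin (j.+1%:R * t) * cos (j%:R * t) - cos (j.+1%:R * t) * sin (j%:R * t).
    by rewrite -sinB; congr sin; rewrite -addn1 natrD; ring.
  move: sj; move: (j.+1%:R * t) (j%:R * t) => x y sx ->.
  by field; rewrite gt_eqF.
rewrite -c1E -[X in angle X _]c0E.
clearbody c => {c0E c1E cdot kt}.
have step j : angle (c j) (c j.+1) = angle (c 0%N) (c 1%N).
  elim: j => [|j <-]; first by [].
  have pp : dot (c j.+1) (c j.+1) *: c j.+1 = c j.+1 by rewrite c1 scale1r.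
  by rewrite angle_sym -(angle_axis_reflection (c j) (c j.+1) pp) cS cQ.
have sum j : (j <= k)%N -> angle (c 0%N) (c j) = j%:R * angle (c 0%N) (c 1%N).
  elim: j => [|j IH] jk; first by rewrite angle_refl mul0r.
  have [->|j0] := eqVneq j 0%N; first by rewrite mul1r.
  have [|x [y [x0 y0 xy cj]]] := cbetween j; first by rewrite lt0n j0.
  rewrite (angle_between x0 y0 xy cj) step IH ?(ltnW jk) //.
  by rewrite -[in RHS]addn1 natrD mulrDl mul1r.
rewrite -(sum k) //; exact: angle_le_pi.
Qed.

(** Let t be the geometric angle of u and v. For the largest k with k t < pi,
    the bound k * angle u v <= pi gives angle u v * (pi - t) <= pi t, so that
    angle u v is at most t asymptotically, and t is equivalent to the chord
    2 sin (t / 2). *)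
Lemma angle_le_chord (e : R) : 0 < e -> exists2 d, 0 < d &
  forall u v, dot u u = 1 -> dot v v = 1 -> enorm (u - v) < d ->
    angle u v <= (1 + e) * enorm (u - v).
Proof.
(* The chord-to-arc and the arc-to-angle estimates each lose a factor 1 + a,
   and (1 + a) ^ 2 <= 1 + 3 a <= 1 + e. *)
move=> e0; pose a : R := Num.min 1 (e / 3).
have a0 : 0 < a by rewrite lt_min ltr01 divr_gt0.
have a1 : a <= 1 by rewrite ge_min lexx.
have ae : a <= e / 3 by rewrite ge_min lexx orbT.
have pi0 := pi_gt0 R.
have [t1 t10 ct1] : exists2 t1 : R, 0 < t1 & forall x : R, `|x| < t1 -> (1 + a)^-1 < cos x.
  have : \forall x \near (0 : R), (1 + a)^-1 < cos x.
    have := @continuous_cos R 0; rewrite /continuous_at cos0 => /cvgr_gt; apply.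
    by rewrite invf_lt1 ?ltrDl // addr_gt0.
  move=> /nbhs_ballP[t1 /= t10 H]; exists t1 => // x xt; apply: H.
  by rewrite /ball /= sub0r normrN.
pose t0 := Num.min t1 (pi * a / (1 + a)).
have t00 : 0 < t0 by rewrite lt_min t10 divr_gt0 // ?mulr_gt0 // addr_gt0.
have t0t1 : t0 <= t1 by rewrite ge_min lexx.
have t0a : t0 <= pi * a / (1 + a) by rewrite ge_min lexx orbT.
have t0pi : t0 < pi.
  by apply: le_lt_trans t0a _; rewrite ltr_pdivrMr ?addr_gt0 // ltr_pM2l // ltrDr.
have ct0 : cos t0 < 1.
  by rewrite -cos0 ltr_cos // ?in_itv /= ?lexx ?(ltW t00) ?(ltW t0pi) ?ltW.
exists (Num.sqrt (2 - 2 * cos t0)); first by rewrite sqrtr_gt0; lra.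
move=> u v u1 v1 uvd.
have r0 := enorm_ge0 (u - v).
have r2 : enorm (u - v) ^+ 2 = 2 - 2 * dot u v.
  by rewrite sqr_enorm !dotE u1 v1 (dotC v u); ring.
have cuv : cos t0 < dot u v.
  have : enorm (u - v) ^+ 2 < Num.sqrt (2 - 2 * cos t0) ^+ 2.
    by rewrite ltr_pXn2r // nnegrE sqrtr_ge0.
  rewrite r2 sqr_sqrtr; last by lra.
  by lra.
have [vu|vu] := eqVneq v (dot u v *: u).
  have uv1 : dot u v = 1.
    have : dot u v ^+ 2 = 1.
      by rewrite -[RHS]v1 {2 3}vu !dotE u1; ring.
    have := cos_geN1 t0; move: cuv; move: (dot u v) => x xt ct x2.
    have /eqP : (x - 1) * (x + 1) = 0 by rewrite -subr_sqr_1 x2 subrr.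
    by rewrite mulf_eq0 => /orP[] /eqP; lra.
  by rewrite vu uv1 scale1r angle_refl subrr mulr_ge0 ?enorm_ge0 //; lra.
pose w := v - dot u v *: u.
have w0 : w != 0 by rewrite subr_eq0.
pose b := direction w.
have b1 : dot b b = 1 by apply/enorm1P/enorm_direction.
have ub : dot u b = 0.
  by rewrite /b /direction dotZr /w !dotE u1; ring.
have w2 : enorm w ^+ 2 = 1 - dot u v ^+ 2.
  by rewrite sqr_enorm /w !dotE u1 v1 (dotC v u); ring.
have w_gt0 : 0 < enorm w by rewrite enorm_gt0.
have uv1 : -1 <= dot u v <= 1 by apply/andP; split; nra.
pose t := acos (dot u v).
have ct : cos t = dot u v by apply: acosK; rewrite in_itv.
have st : sin t = enorm w.
  by rewrite sin_acos // -w2 sqrtr_sqr ger0_norm // ltW.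
have tt0 : t < t0.
  rewrite -ltr_cos ?in_itv /= ?(ltW t00) ?(ltW t0pi) ?acos_ge0 ?acos_lepi //.
  by rewrite ct.
have t_gt0 : 0 < t.
  rewrite lt_def acos_ge0 // andbT; apply/eqP => t_eq0.
  by move: w_gt0; rewrite -st t_eq0 sin0 ltxx.
have vE : v = cos t *: u + sin t *: b.
  by rewrite ct st directionK addrC subrK.
(* k + 1 steps of size t exceed pi, hence k t >= pi - t. *)
have D : angle u v * (pi - t) <= pi * t.
  have [k kt] : exists k : nat, k%:R * t < pi <= k.+1%:R * t.
    have ex : exists k : nat, pi <= k.+1%:R * t.
      exists (Num.bound (pi / t)); rewrite -ler_pdivrMr //.
      apply: le_trans (ltW (archi_boundP _)) _; first by rewrite divr_ge0 ?ltW.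
      by rewrite ler_nat.
    case: (ex_minnP ex) => k kP kmin; exists k; rewrite kP andbT.
    case: k kP kmin => [|k] _ kmin; first by rewrite mul0r.
    by rewrite ltNge; apply/negP => /kmin; rewrite ltnn.
  have /andP[kt1 kt2] := kt.
  have := equidistant_angle u1 b1 ub t_gt0 kt1; rewrite -vE => kD.
  have := angle_ge0 u v.
  move: kt2; rewrite -addn1 natrD; nra.
have tr : t <= (1 + a) * enorm (u - v).
  have h0 : 0 < t / 2 by rewrite divr_gt0.
  have sr : enorm (u - v) = 2 * sin (t / 2).
    have s0 : 0 <= 2 * sin (t / 2).
      by rewrite mulr_ge0 // sin_ge0_pi // (ltW h0) /=; lra.
    apply/eqP; rewrite -(@eqrXn2 _ 2) // r2 -ct; apply/eqP.
    rewrite {1}(_ : t = (t / 2) *+ 2); last by rewrite mulr2n; lra.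
    by rewrite cos_mulr2n cos2sin2; ring.
  have [x /[!in_itv]/= /andP[x0 xt] E] :=
    @MVT R sin cos 0 (t / 2) h0 (fun (y : R) _ => is_derive_sin y)
      (continuous_subspaceT (@continuous_sin R)).
  move: E; rewrite sin0 !subr0 => E.
  have cx : (1 + a)^-1 < cos x by apply: ct1; rewrite gtr0_norm //; lra.
  have : 1 < cos x * (1 + a) by rewrite -ltr_pdivrMr ?div1r // addr_gt0.
  rewrite sr E; nra.
have D0 := angle_ge0 u v.
have : pi <= (pi - t) * (1 + a).
  have : t * (1 + a) <= pi * a.
    by rewrite -ler_pdivlMr ?addr_gt0 //; lra.
  by lra.
move=> H.
have : angle u v * pi <= pi * (t * (1 + a)) by nra.
rewrite mulrC ler_pM2l // => H2.
have : (1 + a) * (1 + a) <= 1 + e by nra.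
nra.
Qed.

End crofton_angle.

(** * The length of the tangent indicatrix *)

Section coordinates.
Context {R : realType} {n : nat}.
Implicit Types (c : R -> 'rV[R]_n) (t : R).

Lemma is_derive_coord c t j : derivable c t 1 ->
  is_derive t 1 (fun x => c x 0 j : R) (derive1 c t 0 j).
Proof.
move=> dc; split; first by move/derivable_mxP : dc.
by rewrite derive1E derive_mx // mxE.
Qed.

Lemma is_derive_rV c t (W : 'rV[R]_n) :
  (forall j, is_derive t 1 (fun x => c x 0 j : R) (W 0 j)) ->
  derivable c t 1 /\ derive1 c t = W.
Proof.
move=> dc; have dct : derivable c t 1.
  by apply/derivable_mxP => i j; rewrite (ord1 i); case: (dc j).
split => //; apply/rowP => j; rewrite derive1E derive_mx // mxE.
by case: (dc j).
Qed.

Lemma continuous_coord c t j : {for t, continuous c} ->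
  {for t, continuous (fun x => c x 0 j : R)}.
Proof.
move=> cc; apply: (@continuous_comp _ _ _ c (fun M : 'rV[R]_n => M 0 j)) => //.
exact: coord_continuous.
Qed.

Lemma continuous_dot (c d : R -> 'rV[R]_n) t :
  (forall j, {for t, continuous (fun x => c x 0 j : R)}) ->
  (forall j, {for t, continuous (fun x => d x 0 j : R)}) ->
  {for t, continuous (fun x => dot (c x) (d x))}.
Proof.
move=> cc cd; rewrite /dot; elim: (index_enum _) => [|i s IH].
  rewrite [F in {for t, continuous F}](_ : _ = fun=> 0); first exact: cst_continuous.
  by apply/funext => x; rewrite big_nil.
rewrite [F in {for t, continuous F}](_ : _ = (fun x => c x 0 i * d x 0 i) \+
    (fun x => \sum_(j <- s) c x 0 j * d x 0 j)); last first.
  by apply/funext => x; rewrite big_cons.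
by apply: continuousD => //; apply: continuousM; [exact: cc|exact: cd].
Qed.

Lemma is_derive_dot (c d : R -> 'rV[R]_n) t (c' d' : 'rV[R]_n) :
  (forall j, is_derive t 1 (fun x => c x 0 j : R) (c' 0 j)) ->
  (forall j, is_derive t 1 (fun x => d x 0 j : R) (d' 0 j)) ->
  is_derive t 1 (fun x => dot (c x) (d x)) (dot c' (d t) + dot (c t) d').
Proof.
move=> dc dd.
rewrite [X in is_derive _ _ X _](_ : _ = \sum_(j < n) (fun x => c x 0 j * d x 0 j)); last first.
  by apply/funext => x; rewrite fct_sumE.
rewrite /dot -big_split /=.
apply: is_derive_sum => j.
apply: is_derive_eq (is_deriveM (dc j) (dd j)) _.
by rewrite addrC /GRing.scale /= [d t 0 j * _]mulrC.
Qed.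

End coordinates.

Section arc.
Context {R : realType} {n : nat} (c : R -> 'rV[R]_n).
Hypothesis c_arc : regular_C2_arc c.
Notation lam := (@lebesgue_measure R).
Notation v := (derive1 c).
Notation A := (derive1 (derive1 c)).
Notation T := (unit_tangent c).

(** The derivative of the unit tangent, by the quotient rule. *)
Definition tangent_derivative (t : R) : 'rV[R]_n :=
  (enorm (v t))^-1 *: A t - ((enorm (v t))^-1 ^+ 3 * dot (v t) (A t)) *: v t.

Notation W := tangent_derivative.

Lemma velocity_coord (t : R) (j : 'I_n) : is_derive t 1 (fun x => v x 0 j : R) (A t 0 j).
Proof. by apply: is_derive_coord; case: c_arc. Qed.

Lemma continuous_velocity_coord (t : R) (j : 'I_n) : {for t, continuous (fun x => v x 0 j : R)}.
Proof.
by have [d _] := velocity_coord t j; apply/differentiable_continuous/derivable1_diffP.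
Qed.

Lemma continuous_accel_coord (t : R) (j : 'I_n) : {for t, continuous (fun x => A x 0 j : R)}.
Proof. by apply: continuous_coord; case: c_arc => _ _ + _; apply. Qed.

Lemma is_derive_inv_speed (t : R) : v t != 0 ->
  is_derive t 1 (fun x => (enorm (v x))^-1 : R) (- (enorm (v t))^-1 ^+ 3 * dot (v t) (A t)).
Proof.
move=> vt; have s0 : 0 < enorm (v t) by rewrite enorm_gt0.
have q0 : 0 < dot (v t) (v t) by rewrite -sqr_enorm exprn_gt0.
have dq := is_derive_dot (velocity_coord t) (velocity_coord t).
have ds := @is_derive1_comp R Num.sqrt (fun x => dot (v x) (v x)) t _ _ (is_derive1_sqrt q0) dq.
apply: is_derive_eq (is_deriveV _ ds) _; first by rewrite gt_eqF.
rewrite /= -/(enorm (v t)) (dotC (A t)) /GRing.scale /=.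
by field; rewrite gt_eqF.
Qed.

Lemma is_derive_unit_tangent (t : R) (j : 'I_n) : v t != 0 ->
  is_derive t 1 (fun x => T x 0 j : R) (W t 0 j).
Proof.
move=> vt; rewrite [F in is_derive _ _ F _](_ : _ =
  (fun x => (enorm (v x))^-1 : R) * (fun x => v x 0 j : R)); last first.
  by apply/funext => x; rewrite /unit_tangent /direction mxE.
apply: is_derive_eq (is_deriveM (is_derive_inv_speed vt) (velocity_coord t j)) _.
by rewrite /W /GRing.scale /= !mxE; ring.
Qed.

Lemma derive1_unit_tangent (t : R) : v t != 0 -> derive1 T t = W t.
Proof. by move=> vt; apply: (is_derive_rV (fun j => is_derive_unit_tangent j vt)).2. Qed.

Lemma continuous_tangent_derivative (t : R) : v t != 0 ->
  {for t, continuous (fun x => enorm (W x) : R)}.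
Proof.
move=> vt.
have cs : {for t, continuous (fun x => (enorm (v x))^-1 : R)}.
  have [d _] := is_derive_inv_speed vt.
  by apply/differentiable_continuous/derivable1_diffP.
have cvA : {for t, continuous (fun x => dot (v x) (A x) : R)}.
  apply: continuous_dot => j; first exact: continuous_velocity_coord.
  exact: continuous_accel_coord.
have cW j : {for t, continuous (fun x => W x 0 j : R)}.
  rewrite [F in {for t, continuous F}](_ : _ =
    ((fun x => (enorm (v x))^-1) \* (fun x => A x 0 j)) \-
    ((fun x => (enorm (v x))^-1 ^+ 3 * dot (v x) (A x)) \* (fun x => v x 0 j))); last first.
    by apply/funext => x; rewrite /W !mxE.
  apply: continuousB; apply: continuousM => //.
  - exact: continuous_accel_coord.
  - apply: continuousM => //.
    rewrite [F in {for t, continuous F}](_ : _ =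
      (fun x => (enorm (v x))^-1) \* ((fun x => (enorm (v x))^-1) \* (fun x => (enorm (v x))^-1))).
      by apply: continuousM => //; exact: continuousM.
    by apply/funext => x /=; rewrite !exprS expr0 mulr1.
  - exact: continuous_velocity_coord.
rewrite /enorm; apply: (@continuous_comp _ _ _ (fun x => dot (W x) (W x)) Num.sqrt).
  exact: continuous_dot.
exact: sqrt_continuous.
Qed.

Lemma continuous_unit_tangent (t : R) (j : 'I_n) : v t != 0 ->
  {for t, continuous (fun x => T x 0 j : R)}.
Proof.
move=> vt; have [d _] := is_derive_unit_tangent j vt.
by apply/differentiable_continuous/derivable1_diffP.
Qed.

Lemma velocity_neq0 (t : R) : t \in `[0, 1] -> v t != 0.
Proof. by rewrite in_itv /=; case: c_arc => _ _ _; apply. Qed.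

(** L is the length of the tangent indicatrix, the integral of |T'|: since
    ds = |c'| dt, its total variation is the curvature of the arc. The
    inequality |T b - T a| <= L b - L a is obtained without vector integration,
    from the monotonicity of L t |w| - <T t, w> for w = T b - T a. The Lipschitz
    bound replaces uniform continuity in the subdivisions of the arc. *)
Lemma indicatrix_length : exists (L : R -> R) (M : R),
  [/\ arc_curvature c = (L 1 - L 0)%:E,
      forall a b, 0 <= a -> a <= b -> b <= 1 -> enorm (T b - T a) <= L b - L a &
      forall a b, 0 <= a -> a <= b -> b <= 1 -> 0 <= L b - L a <= M * (b - a)].
Proof.
pose g t : R := enorm (W t).
have cg t : t \in `[0, 1] -> {for t, continuous g}.
  by move=> t01; apply: continuous_tangent_derivative; exact: velocity_neq0.
have cg01 : {within `[0, 1], continuous g}.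
  by apply: continuous_in_subspaceT => t /[1!inE] t01; exact: cg.
have ig : lam.-integrable `[0, 1] (EFin \o g).
  apply: continuous_compact_integrable => //; exact: segment_compact.
pose L t := (\int[lam]_(s in `[0, t]) g s)%R.
have dL t : t \in `]0, 1[ -> derivable L t 1 /\ derive1 L t = g t.
  move=> t01; have /andP[t0 t1] : 0 < t < 1 by move: t01; rewrite in_itv.
  apply: (continuous_FTC1_closed t1 ig t0); apply: cg.
  by rewrite in_itv /= !ltW.
have isL (t : R) : t \in `]0, 1[ -> is_derive t 1 L (g t).
  move=> /dL[d1 d2]; split; first exact: d1.
  by rewrite -derive1E; exact: d2.
have cL : {within `[0, 1], continuous L}.
  exact: parameterized_integral_continuous.
have L0 : L 0 = 0 by rewrite /L set_itv1 Rintegral_set1.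
have [m _ gm] := EVT_max ler01 cg01.
exists L, (g m).
have curv : arc_curvature c = (L 1 - L 0)%:E.
  rewrite L0 subr0 /L /Rintegral fineK; last exact: integrable_fin_num.
  have mg := measurable_int _ ig.
  rewrite -integral_itv_obnd_cbnd; last first.
    by apply: measurable_funS mg => //; exact: subset_itv_oc_cc.
  rewrite -integral_itv_bndo_bndc; last first.
    by apply: measurable_funS mg => //; exact: subset_itv_oo_cc.
  apply: eq_integral => t; rewrite inE /= in_itv /= => /andP[t0 t1].
  have vt : v t != 0 by apply: velocity_neq0; rewrite in_itv /= !ltW.
  rewrite /curvature_vector derive1_unit_tangent // enormZ ger0_norm; last first.
    by rewrite invr_ge0 enorm_ge0.
  by rewrite mulrAC mulVf ?mul1r // enorm_eq0.
have gE t : g t = enorm (W t) by [].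
clearbody L g => {cg cg01 ig dL}.
have Lmono (a b : R) : 0 <= a -> a <= b -> b <= 1 -> L a <= L b.
  move=> a0 ab b1; apply: (@ger0_derive1_le_cc R L 0 1) => //.
  - by move=> x /isL[].
  - by move=> x /isL[_]; rewrite derive1E => ->; rewrite gE enorm_ge0.
  - by rewrite in_itv /= a0 (le_trans ab).
  - by rewrite in_itv /= b1 (le_trans a0).
split => // a b a0 ab b1; last first.
  rewrite subr_ge0 Lmono //=.
  have sub x : x \in `]a, b[ -> x \in `]0, 1[.
    rewrite !in_itv /= => /andP[ax xb].
    by rewrite (le_lt_trans a0 ax) (lt_le_trans xb b1).
  have dLab x : x \in `]a, b[ -> is_derive x 1 L (g x).
    by move=> /sub; exact: isL.
  have cLab : {within `[a, b], continuous L}.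
    apply: continuous_subspaceW cL => x /=; rewrite !in_itv /= => /andP[ax xb].
    by rewrite (le_trans a0 ax) (le_trans xb b1).
  have [x xab ->] := MVT_segment ab dLab cLab.
  apply: ler_wpM2r; first by rewrite subr_ge0.
  apply: gm.
  by move: xab; rewrite !in_itv /= => /andP[ax xb]; rewrite (le_trans a0 ax) (le_trans xb b1).
have [w wE] : {w : 'rV[R]_n | w = T b - T a} by exists (T b - T a).
rewrite -wE.
have [w0|w0] := eqVneq w 0.
  by rewrite w0 /enorm dot0l sqrtr0 subr_ge0 Lmono.
pose phi t := L t * enorm w - dot (T t) w.
have dphi (t : R) : t \in `]0, 1[ -> is_derive t 1 phi (g t * enorm w - dot (W t) w).
  move=> t01; have vt : v t != 0.
    by apply: velocity_neq0; apply: subset_itv_oo_cc t01.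
  have h1 := isL _ t01.
  have h2 : is_derive t 1 (fun x => dot (T x) w) (dot (W t) w).
    have dw j : is_derive t 1 (fun=> w 0 j : R) ((0 : 'rV[R]_n) 0 j).
      by rewrite [X in is_derive _ _ _ X]mxE; exact: is_derive_cst.
    apply: is_derive_eq (is_derive_dot (fun j => is_derive_unit_tangent j vt) dw) _.
    by rewrite dot0r addr0.
  have h3 : is_derive t 1 phi _ := is_deriveB (is_deriveM h1 (is_derive_cst (enorm w) t 1)) h2.
  apply: is_derive_eq h3 _.
  by congr (_ - _); rewrite scaler0 add0r; exact: mulrC.
have cTw (x : R) : x \in `[0, 1] -> {for x, continuous (fun y => dot (T y) w : R)}.
  move=> x01; apply: continuous_dot => j; last exact: cst_continuous.
  by apply: continuous_unit_tangent; exact: velocity_neq0.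
have cT : {within `[0, 1], continuous (fun y => dot (T y) w : R)}.
  by apply: continuous_in_subspaceT => x /[1!inE] x01; exact: cTw.
have cphi : {within `[0, 1], continuous phi}.
  move=> x; apply: cvgB; last exact: cT.
  by apply: cvgM; [exact: cL|exact: cvg_cst].
have phi_ab : phi a <= phi b.
  apply: (@ger0_derive1_le_cc R phi 0 1) => //.
  - by move=> x /dphi[].
  - move=> x /dphi[_]; rewrite derive1E => ->; rewrite subr_ge0 gE; exact: cauchy_schwarz.
  - by rewrite in_itv /= a0 (le_trans ab).
  - by rewrite in_itv /= b1 (le_trans a0).
have w_gt0 : 0 < enorm w by rewrite enorm_gt0.
have ww : dot w w = dot (T b) w - dot (T a) w by rewrite {1}wE dotDl dotNl.
rewrite -(ler_pM2r w_gt0) -expr2 sqr_enorm ww mulrBl.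
move: phi_ab; rewrite /phi.
by move: (L a * _) (L b * _) (dot (T a) w) (dot (T b) w) => ? ? ? ?; lra.
Qed.
End arc.

(** * Polygonal lengths and Fenchel's inequality *)

Section path_length.
Context {R : realType} {V : eqType} (d : V -> V -> R).

Fixpoint path_length (x : V) (s : seq V) : R :=
  if s is y :: s' then d x y + path_length y s' else 0.

Lemma path_length_cat x s t :
  path_length x (s ++ t) = path_length x s + path_length (last x s) t.
Proof. by elim: s x => [|y s IH] x /=; rewrite ?add0r // IH addrA. Qed.

Hypothesis dxx : forall x, d x x = 0.
Hypothesis dC : forall x y, d x y = d y x.
Hypothesis dD : forall y x z, d x z <= d x y + d y z.

Lemma path_length_ge x s p : p \in x :: s ->
  d x p + d p (last x s) <= path_length x s.
Proof.
elim: s x p => [|y s IH] x p.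
  by rewrite inE => /eqP->; rewrite /= dxx addr0.
rewrite inE => /predU1P[->|py] /=.
  rewrite dxx add0r; apply: le_trans (dD y _ _) _; rewrite lerD2l.
  by have := IH y y (mem_head y s); rewrite dxx add0r.
by have := dD y x p; have := IH y p py; lra.
Qed.

(** The path meets p and q in some order; cut it there and close it up. *)
Lemma closed_path_length x s p q : p \in x :: s -> q \in x :: s ->
  last x s = x -> 2 * d p q <= path_length x s.
Proof.
move=> ps qs lx.
have : d x p + d p q + d q (last x s) <= path_length x s \/
       d x q + d p q + d p (last x s) <= path_length x s.
  elim: s x {lx} ps qs => [|y s IH] x.
    by rewrite !inE => /eqP-> /eqP->; left; rewrite /= dxx !addr0.
  rewrite inE => /predU1P[->|py].
    by move=> /path_length_ge; left; rewrite dxx add0r.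
  rewrite inE => /predU1P[->|qy].
    have /path_length_ge : p \in x :: y :: s by rewrite inE py orbT.
    by right; rewrite dxx add0r dC.
  by have := dD y x p; have := dD y x q; case: (IH y py qy) => /=; [left|right]; lra.
rewrite lx; have := dD x p q; rewrite (dC p x) (dC q x).
by case; lra.
Qed.

End path_length.

Lemma path_length_map (R : realType) (V W : eqType) (d : W -> W -> R) (f : V -> W) x s :
  path_length d (f x) (map f s) = path_length (fun p q => d (f p) (f q)) x s.
Proof. by elim: s x => //= y s IH x; rewrite IH. Qed.

Lemma path_length_rev (R : realType) (V : eqType) (d : V -> V -> R) x s :
  (forall x y, d x y = d y x) ->
  path_length d (last x s) (rev (belast x s)) = path_length d x s.
Proof.
move=> dC; elim: s x => //= y s IH x.
rewrite rev_cons -cats1 path_length_cat IH /= addr0 addrC dC; congr (_ + _).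
by case: s {IH} => //= z s; rewrite rev_cons last_rcons.
Qed.

Section turning.
Context {R : realType} {n : nat}.
Notation mR := (measurableTypeR R).
Notation vec := vec_of_tuple.
Notation tR := (n.-tuple mR).
Implicit Types (u v D : 'rV[R]_n) (K : R).

(** A record of the curves with initial direction u, final direction v,
    displacement D and total curvature at most K, in the form that is stable
    under concatenation and reversal. P N is the N-th sample of tangent
    directions along the curve. The last two clauses hold because the integral
    of <x, T> is <x, D>: when <x, D> >= 0 the linear form x is positive on some
    tangent, unless it vanishes on all of them, which genericity excludes. When
    D = 0 both signs occur. *)
Definition turning u v K D := exists (P : nat -> seq 'rV[R]_n) (G : seq 'rV[R]_n),
  [/\ forall N, exists2 s, P N = u :: s & last u s = v /\ path_length angle u s <= K,
      all (fun w => w != 0) G,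
      forall x : tR, generic G x -> 0 <= dot (vec x) D ->
        \forall N \near \oo, has (fun p => 0 < dot (vec x) p) (P N) &
      forall x : tR, generic G x -> dot (vec x) D <= 0 ->
        \forall N \near \oo, has (fun p => dot (vec x) p < 0) (P N)].

(** The joint contributes its exterior angle. If <x, D1 + D2> >= 0 then one of
    the two summands is nonnegative, and that part has an ascending tangent. *)
Lemma turning_cat u1 v1 K1 D1 u2 v2 K2 D2 :
  turning u1 v1 K1 D1 -> turning u2 v2 K2 D2 ->
  turning u1 v2 (K1 + angle v1 u2 + K2) (D1 + D2).
Proof.
move=> [P1 [G1 [P1s G10 P1p P1n]]] [P2 [G2 [P2s G20 P2p P2n]]].
exists (fun N => P1 N ++ P2 N), (G1 ++ G2); split.
- move=> N; have [s1 P1E [l1 k1]] := P1s N; have [s2 P2E [l2 k2]] := P2s N.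
  exists (s1 ++ u2 :: s2); first by rewrite P1E P2E.
  rewrite last_cat /= l2; split => //.
  by rewrite path_length_cat l1 /= -addrA lerD // lerD2l.
- by rewrite all_cat G10.
- move=> x; rewrite /generic all_cat => /andP[x1 x2]; rewrite dotDr => D0.
  have [D10|D10] := leP 0 (dot (vec x) D1).
    by near=> N; rewrite has_cat; apply/orP; left; near: N; exact: P1p.
  by near=> N; rewrite has_cat; apply/orP; right; near: N; apply: P2p => //; lra.
- move=> x; rewrite /generic all_cat => /andP[x1 x2]; rewrite dotDr => D0.
  have [D10|D10] := leP (dot (vec x) D1) 0.
    by near=> N; rewrite has_cat; apply/orP; left; near: N; exact: P1n.
  by near=> N; rewrite has_cat; apply/orP; right; near: N; apply: P2n => //; lra.
Unshelve. all: by end_near. Qed.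

Lemma turning_rev u v K D : turning u v K D -> turning (- v) (- u) K (- D).
Proof.
move=> [P [G [Ps G0 Pp Pn]]].
exists (fun N => map -%R (rev (P N))), G; split => //.
- move=> N; have [s PE [l k]] := Ps N.
  exists (map -%R (rev (belast u s))).
    by rewrite PE lastI rev_rcons l.
  rewrite -l last_map path_length_map; split.
    by congr (- _); case: s {PE l k} => //= z s; rewrite rev_cons last_rcons.
  rewrite (_ : (fun p q => _) = angle).
    by rewrite path_length_rev //; exact: angle_sym.
  by apply/funext => p; apply/funext => q; exact: angle_opp.
- move=> x xG; rewrite dotNr oppr_ge0 => D0.
  near=> N; rewrite has_map has_rev.
  rewrite (@eq_has _ _ (fun p => dot (vec x) p < 0)); last first.
    by move=> p /=; rewrite dotNr oppr_gt0.
  by near: N; exact: Pn.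
- move=> x xG; rewrite dotNr oppr_le0 => D0.
  near=> N; rewrite has_map has_rev.
  rewrite (@eq_has _ _ (fun p => 0 < dot (vec x) p)); last first.
    by move=> p /=; rewrite dotNr oppr_lt0.
  by near: N; exact: Pp.
Unshelve. all: by end_near. Qed.

Lemma angle_path_length u s :
  bounded_mfun (fun x : tR => path_length (fun p q => `|sgn p x - sgn q x|) u s) /\
  path_length angle u s =
    pi / 2 * mean (fun x : tR => path_length (fun p q => `|sgn p x - sgn q x|) u s).
Proof.
elim: s u => [|v s IH] u /=.
  by split; [exact: bounded_mfun_cst|rewrite mean_cst mulr0].
have [bs ->] := IH v.
have buv : bounded_mfun (fun x : tR => `|sgn u x - sgn v x|).
  by apply: bounded_mfun_norm; apply: bounded_mfunB; exact: bounded_mfun_sgn.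
split; first exact: bounded_mfunD.
rewrite meanD // mulrDr; congr (_ + _).
rewrite /angle -mulrA; congr (_ * _); rewrite -meanZ //.
by congr mean; apply/funext => x; rewrite mulrC.
Qed.

(** Fenchel's inequality for the closed curve obtained by joining v to u. The
    sampled tangents form a closed polygon on the sphere of length at most
    K + angle v u, and its length is pi/2 times the mean variation of the signs
    of <x, T>. For generic x both signs occur in fine samples, so this cyclic
    variation is at least 4. *)
Lemma fenchel u v K : turning u v K 0 -> 2 * pi <= K + angle v u.
Proof.
move=> [P [G [Ps G0 Pp Pn]]].
(* Divided by 4, the cyclic variation of the signs of the N-th sample; the
   sample is closed up by its first point u. *)
pose f N x := 4^-1 * path_length (fun p q => `|sgn p x - sgn q x|) u (rcons (behead (P N)) u).
have pi0 := pi_gt0 R.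
suff : 1 <= (K + angle v u) / (2 * pi).
  by rewrite ler_pdivlMr ?mul1r // mulr_gt0.
have lastE N : last u (rcons (behead (P N)) u) = u by rewrite last_rcons.
have closed N x p q : p \in u :: rcons (behead (P N)) u -> q \in u :: rcons (behead (P N)) u ->
    2 * `|sgn p x - sgn q x| <=
    path_length (fun p q => `|sgn p x - sgn q x|) u (rcons (behead (P N)) u).
  move=> pP qP; apply: (closed_path_length _ _ _ pP qP (lastE N)) => [r|r s|r s t].
  - by rewrite subrr normr0.
  - by rewrite distrC.
  - exact: ler_distD.
apply: (@mean_eventually_ge1 R n G f) => //.
- by move=> N; apply: bounded_mfunZ; exact: (angle_path_length _ _).1.
- by move=> N x; rewrite mulr_ge0 // (le_trans _ (closed N x u u _ _)) ?mem_head // mulr_ge0.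
- move=> x xG.
  have x0 : dot (vec x) 0 = 0 by rewrite dot0r.
  near=> N.
  have /hasP[p pP p0] : has (fun p => 0 < dot (vec x) p) (P N).
    by near: N; apply: Pp; rewrite ?x0.
  have /hasP[q qP q0] : has (fun p => dot (vec x) p < 0) (P N).
    by near: N; apply: Pn; rewrite ?x0.
  have [s PE _] := Ps N.
  have sub r : r \in P N -> r \in u :: rcons (behead (P N)) u.
    by rewrite PE /= !inE mem_rcons inE => /orP[->//|->]; rewrite !orbT.
  rewrite /f -ler_pdivrMl ?invr_gt0 // invrK mulr1.
  apply: le_trans (closed N x p q (sub _ pP) (sub _ qP)).
  by rewrite /sgn (gtr0_sg p0) (ltr0_sg q0) opprK ger0_norm; lra.
- move=> N; rewrite ler_pdivlMr ?mulr_gt0 //.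
  have [s PE [l k]] := Ps N.
  have [b E] := angle_path_length u (rcons (behead (P N)) u).
  rewrite /f meanZ // (_ : _ * (2 * pi) = pi / 2 * mean (fun x : tR =>
    path_length (fun p q => `|sgn p x - sgn q x|) u (rcons (behead (P N)) u))); last by field.
  rewrite -E PE /= -cats1 path_length_cat l /= addr0; lra.
Unshelve. all: by end_near. Qed.

End turning.

(** * The turning of a regular arc *)

Section turning_arc.
Context {R : realType} {n : nat} (c : R -> 'rV[R]_n).
Hypothesis c_arc : regular_C2_arc c.
Notation mR := (measurableTypeR R).
Notation vec := vec_of_tuple.
Notation v := (derive1 c).
Notation T := (unit_tangent c).

Lemma unit_tangent_dot1 (t : R) : t \in `[0, 1] -> dot (T t) (T t) = 1.
Proof. by move=> t01; apply/enorm1P/enorm_direction/velocity_neq0. Qed.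

(** Subdivide finely: on each piece the angle is at most 1 + e times the chord,
    and the chords are bounded by the increments of L, which telescope. *)
Lemma angle_le_arc_length (L : R -> R) (M : R) :
  (forall a b : R, 0 <= a -> a <= b -> b <= 1 -> enorm (T b - T a) <= L b - L a) ->
  (forall a b : R, 0 <= a -> a <= b -> b <= 1 -> 0 <= L b - L a <= M * (b - a)) ->
  forall a b : R, 0 <= a -> a <= b -> b <= 1 -> angle (T a) (T b) <= L b - L a.
Proof.
move=> TL LM a b a0 ab b1.
have Lab : 0 <= L b - L a by have /andP[] := LM a b a0 ab b1.
suff H e : 0 < e -> angle (T a) (T b) <= (1 + e) * (L b - L a).
  apply/ler_addgt0Pr => e e0.
  have D0 : 0 < L b - L a + 1 by lra.
  apply: le_trans (H (e / (L b - L a + 1)) _) _; first by rewrite divr_gt0.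
  rewrite mulrDl mul1r lerD2l mulrAC ler_pdivrMr // ler_wpM2l //; lra.
move=> e0; have [d d0 chord] := @angle_le_chord R n e e0.
pose N := Num.bound (`|M| * (b - a) / d).
have NP : `|M| * (b - a) / d < N.+1%:R.
  apply: lt_le_trans (archi_boundP _) _; last by rewrite ler_nat.
  by rewrite divr_ge0 ?(ltW d0) // mulr_ge0 // subr_ge0.
pose h : R := (b - a) / N.+1%:R.
have N0 : 0 < N.+1%:R :> R by rewrite ltr0n.
have h0 : 0 <= h by rewrite divr_ge0 ?subr_ge0 // (ltW N0).
have hd : `|M| * h < d.
  by rewrite /h mulrA ltr_pdivrMr // [ltRHS]mulrC -ltr_pdivrMr.
pose t (k : nat) : R := a + k%:R * h.
have tN : t N.+1 = b by rewrite /t /h mulrCA divff ?gt_eqF // mulr1 addrC subrK.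
have t0 : t 0%N = a by rewrite /t mul0r addr0.
have tS k : t k.+1 = t k + h by rewrite /t -addn1 natrD; ring.
clearbody t.
have tmono k : t k <= t k.+1 by rewrite tS; lra.
have ta k : a <= t k by elim: k => [|k IH]; rewrite ?t0 // (le_trans IH).
have tb k : (k <= N.+1)%N -> t k <= b.
  move=> kN; rewrite -tN -(subnK kN); elim: (N.+1 - k)%N => // j IH.
  by rewrite addSn (le_trans IH).
have step k : (k <= N.+1)%N -> angle (T a) (T (t k)) <= (1 + e) * (L (t k) - L a).
  elim: k => [|k IH] kN; first by rewrite t0 angle_refl subrr mulr0.
  have k0 : 0 <= t k by apply: le_trans a0 (ta k).
  have k1 : t k.+1 <= 1 by apply: le_trans (tb _ kN) b1.
  have Tk : enorm (T (t k) - T (t k.+1)) <= L (t k.+1) - L (t k).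
    by rewrite -enormN opprB; exact: TL.
  have Ld : L (t k.+1) - L (t k) < d.
    have /andP[_] := LM _ _ k0 (tmono k) k1; rewrite tS addrAC subrr add0r => H.
    rewrite -tS in H *; apply: le_lt_trans H (le_lt_trans _ hd).
    by rewrite ler_wpM2r // ler_norm.
  apply: le_trans (angle_triangle (T (t k)) _ _) _.
  apply: le_trans (lerD (IH (ltnW kN)) (chord _ _ _ _ (le_lt_trans Tk Ld))) _.
  - by rewrite unit_tangent_dot1 // in_itv /= k0 (le_trans (tmono k)).
  - by rewrite unit_tangent_dot1 // in_itv /= k1 andbT (le_trans k0).
  rewrite -mulrDr; apply: ler_wpM2l; first by lra.
  move: Tk; move: (enorm _) (L (t k)) (L (t k.+1)) (L a) => ? ? ? ?; lra.
by have := step N.+1 (leqnn _); rewrite tN.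
Qed.

(** Otherwise h = <y, c> does not increase on [0, 1] while h 0 <= h 1, so h is
    constant there and its derivative vanishes at 1/2. *)
Lemma ascending_tangent (y : 'rV[R]_n) : dot y (T (1 / 2)) != 0 ->
  0 <= dot y (c 1 - c 0) -> exists2 t, t \in `]0, 1[ & 0 < dot y (T t).
Proof.
move=> y0 yc; apply: contrapT => H.
have {}H (t : R) : t \in `]0, 1[ -> dot y (v t) <= 0.
  move=> t01; rewrite leNgt; apply/negP => vt; apply: H; exists t => //.
  rewrite /unit_tangent /direction dotZr mulr_gt0 // invr_gt0 enorm_gt0.
  by apply: velocity_neq0 => //; exact: subset_itv_oo_cc t01.
pose h t := dot y (c t).
have dh (t : R) : is_derive t 1 h (dot y (v t)).
  have dy j : is_derive t 1 (fun=> y 0 j : R) ((0 : 'rV[R]_n) 0 j).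
    by rewrite [X in is_derive _ _ _ X]mxE; exact: is_derive_cst.
  have dc j : is_derive t 1 (fun x => c x 0 j : R) (v t 0 j).
    by apply: is_derive_coord; case: c_arc.
  by apply: is_derive_eq (is_derive_dot dy dc) _; rewrite dot0l add0r.
have dh1 (t : R) : derivable h t 1 by case: (dh t).
have dh2 (t : R) : t \in `]0, 1[ -> derive1 h t <= 0.
  by move=> t01; rewrite derive1E; case: (dh t) => _ ->; exact: H.
have ch : {within `[0, 1], continuous h}.
  by apply: derivable_within_continuous => t _.
have hmono (s t : R) : s \in `[0, 1] -> t \in `[0, 1] -> s <= t -> h t <= h s.
  move=> s01 t01 st.
  exact: (ler0_derive1_le_cc (fun t _ => dh1 t) dh2 ch t01 s01 st).
have h01 : h 0 <= h 1 by move: yc; rewrite dotDr dotNr subr_ge0.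
have half01 : (1 / 2 : R) \in `]0, 1[ by rewrite in_itv /=; apply/andP; split; lra.
have [_ d0] : is_derive (1 / 2 : R) 1 h 0.
  apply: (@derive1_at_max _ h 0 1) => //.
  move=> t t01.
  have i0 : (0 : R) \in `[0, 1] by rewrite in_itv /= lexx ler01.
  have i1 : (1 : R) \in `[0, 1] by rewrite in_itv /= lexx ler01.
  have ih : (1 / 2 : R) \in `[0, 1] by exact: subset_itv_oo_cc half01.
  have it : t \in `[0, 1] by exact: subset_itv_oo_cc t01.
  have h2 := hmono _ _ ih i1; apply: (@le_trans _ _ (h 0)).
    by apply: hmono i0 it _; move: t01; rewrite in_itv /= => /andP[/ltW].
  by apply: le_trans h01 (h2 _); lra.
have [_ d1] := dh (1 / 2).
by case/negP: y0; rewrite /unit_tangent /direction dotZr -d1 d0 mulr0.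
Qed.

Lemma sampled_ascending_tangent (y : 'rV[R]_n) : dot y (T (1 / 2)) != 0 ->
  0 <= dot y (c 1 - c 0) -> \forall N \near \oo,
    has (fun p => 0 < dot y p) [seq T (k%:R / N.+1%:R) | k <- iota 0 N.+2].
Proof.
move=> y0 yc; have [t t01 yt] := ascending_tangent y0 yc.
have ct : {for t, continuous (fun s => dot y (T s) : R)}.
  apply: continuous_dot => j; first exact: cst_continuous.
  apply: continuous_unit_tangent => //; apply: velocity_neq0 => //.
  exact: subset_itv_oo_cc t01.
have /nbhs_ballP[r /= r0 Hr] : \forall s \near t, 0 < dot y (T s).
  by move/cvgr_gt: ct; apply.
have /andP[t0 t1] : 0 < t < 1 by move: t01; rewrite in_itv.
suff H N : (Num.bound r^-1 <= N)%N ->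
    has (fun p => 0 < dot y p) [seq T (k%:R / N.+1%:R) | k <- iota 0 N.+2].
  by exists (Num.bound r^-1) => // N /= /H.
move=> rN.
have N0 : 0 < N.+1%:R :> R by rewrite ltr0n.
have Nr : N.+1%:R^-1 < r.
  rewrite -[ltRHS]invrK ltf_pV2 ?posrE ?invr_gt0 //.
  apply: lt_le_trans (archi_boundP _) _; first by rewrite invr_ge0 ltW.
  by rewrite ler_nat; apply: leq_trans rN _.
have tN0 : 0 <= t * N.+1%:R by rewrite mulr_ge0 ?ltW.
have /andP[k1 k2] := truncn_itv tN0.
set k := Num.truncn _ in k1 k2.
rewrite has_map; apply/hasP; exists k.
  rewrite mem_iota leq0n add0n ltnS /=.
  rewrite -(ler_nat R); apply: le_trans k1 _.
  by rewrite ler_piMl ?ltW.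
apply: Hr; rewrite /ball /= ltr_norml; apply/andP; split.
  apply: lt_le_trans (_ : 0 <= _); first by rewrite oppr_lt0.
  by rewrite subr_ge0 ler_pdivrMr.
apply: le_lt_trans Nr; rewrite lerBlDr.
have : t <= k.+1%:R / N.+1%:R by rewrite ler_pdivlMr // ltW.
by rewrite -addn1 natrD mulrDl mul1r addrC.
Qed.

Lemma turning_arc : exists2 K : R, arc_curvature c = K%:E &
  turning (T 0) (T 1) K (c 1 - c 0).
Proof.
have [L [M [curv TL LM]]] := indicatrix_length c_arc.
have angL := angle_le_arc_length TL LM.
exists (L 1 - L 0) => //.
exists (fun N => [seq T (k%:R / N.+1%:R) | k <- iota 0 N.+2]), [:: T (1 / 2)].
have half01 : (1 / 2 : R) \in `[0, 1] by rewrite in_itv /=; apply/andP; split; lra.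
split.
- move=> N; have N0 : 0 < N.+1%:R :> R by rewrite ltr0n.
  exists [seq T (k%:R / N.+1%:R) | k <- iota 1 N.+1]; first by rewrite /= mul0r.
  have len (j m : nat) : (j + m <= N.+1)%N ->
      last (T (j%:R / N.+1%:R)) [seq T (k%:R / N.+1%:R) | k <- iota j.+1 m] =
        T ((j + m)%:R / N.+1%:R) /\
      path_length angle (T (j%:R / N.+1%:R)) [seq T (k%:R / N.+1%:R) | k <- iota j.+1 m] <=
        L ((j + m)%:R / N.+1%:R) - L (j%:R / N.+1%:R).
    elim: m j => [|m IH] j jm; first by rewrite addn0 /= subrr.
    rewrite /=; have [|-> len] := IH j.+1; first by rewrite addSnnS.
    rewrite addnS; split => //.
    have := angL (j%:R / N.+1%:R) (j.+1%:R / N.+1%:R).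
    rewrite addSn in len; move=> H.
    have {}H : angle (T (j%:R / N.+1%:R)) (T (j.+1%:R / N.+1%:R)) <=
        L (j.+1%:R / N.+1%:R) - L (j%:R / N.+1%:R).
      apply: H.
      - by rewrite divr_ge0 // ltW.
      - by rewrite ler_pM2r ?invr_gt0 // ler_nat.
      - rewrite ler_pdivrMr // mul1r ler_nat; apply: leq_trans jm.
        by rewrite addnS ltnS leq_addr.
    by rewrite -addnS in len *; lra.
  have [] := len 0%N N.+1 (leqnn _).
  by rewrite add0n mul0r divff ?gt_eqF.
- rewrite /= andbT -dot_eq0 unit_tangent_dot1 //; exact: oner_neq0.
- by move=> x /andP[x0 _]; exact: sampled_ascending_tangent.
- move=> x /andP[x0 _] xD.
  have := @sampled_ascending_tangent (- vec x).
  rewrite dotNl oppr_eq0 dotNl oppr_ge0 => /(_ x0 xD); apply: filterS => N.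
  by apply: sub_has => p; rewrite dotNl oppr_gt0.
Qed.

End turning_arc.

(** * Net total curvature of trivalent vertices *)

Section ntc.
Context {R : realType} {n : nat}.
Notation mR := (measurableTypeR R).
Notation tR := (n.-tuple mR).
Implicit Types (u v : 'rV[R]_n) (Ts : seq 'rV[R]_n).

(** Signs are odd functions, and the average is invariant under the antipodal map. *)
Lemma mean_sgn u : mean (sgn u) = 0.
Proof.
have z0 : dot (0 : 'rV[R]_n) 0 *: (0 : 'rV[R]_n) = 0 by rewrite scaler0.
have : mean (sgn u) = - mean (sgn u).
  rewrite -{1}(mean_treflection z0 (bounded_mfun_sgn u)) -mulN1r.
  rewrite -meanZ; last exact: bounded_mfun_sgn.
  congr mean; apply/funext => x; rewrite /sgn tuple_of_vecK /axis_reflection.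
  by rewrite scaler0 add0r dotNl sgrN mulN1r.
by lra.
Qed.

Definition total_sgn Ts (x : tR) : R := \sum_(T <- Ts) sgn T x.

Lemma bounded_mfun_total_sgn Ts : bounded_mfun (total_sgn Ts).
Proof. by apply: bounded_mfun_sum => T; exact: bounded_mfun_sgn. Qed.

(** The positive part of s is (|s| + s) / 2, and odd functions have mean zero. *)
Lemma ntcE Ts : ntc Ts = (pi / 2 * mean (fun x => `|total_sgn Ts x|))%:E.
Proof.
have bS := bounded_mfun_total_sgn Ts; have bN := bounded_mfun_norm bS.
pose f x := 2^-1 * (`|total_sgn Ts x| - total_sgn Ts x).
rewrite /ntc (@sphere_averageE _ _ _ f).
- rewrite -EFinM; congr (_%:E); rewrite -mulrA; congr (_ * _).
  rewrite /f meanZ; last exact: bounded_mfunB.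
  rewrite meanD ?(bounded_mfunN bS) //; last exact: bounded_mfunN.
  rewrite (_ : (fun x => - total_sgn Ts x) = (fun x => -1 * total_sgn Ts x)).
    rewrite meanZ // (_ : mean (total_sgn Ts) = 0) ?mulr0 ?addr0 //.
    rewrite mean_sum; last by move=> T; exact: bounded_mfun_sgn.
    by rewrite big1 // => T _; exact: mean_sgn.
  by apply/funext => x; rewrite mulN1r.
- by apply: bounded_mfunZ; exact: bounded_mfunB.
move=> x; rewrite /f (_ : \sum_(T <- Ts) _ = - total_sgn Ts x).
  by case: (ler0P (total_sgn Ts x)) => S0; [rewrite max_r|rewrite max_l]; lra.
rewrite /total_sgn -sumrN; apply: eq_bigr => T _.
by rewrite /chi sg_dot_direction.
Qed.

Lemma ntc_joint u v : ntc [:: - u; v] = (angle u v)%:E.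
Proof.
rewrite ntcE /angle -mulrA -meanZ; last exact/bounded_mfun_norm/bounded_mfun_total_sgn.
congr (_ * mean _)%:E; apply/funext => x.
by rewrite /total_sgn !big_cons big_nil addr0 sgn_opp distrC [- _ + _]addrC mulrC.
Qed.

(** If the three signs agree both sides are 6, otherwise both are 2. *)
Lemma sgr_trivalent (r s t : R) : r != 0 -> s != 0 -> t != 0 ->
  2 * `|Num.sg r + Num.sg s + Num.sg t| =
  `|Num.sg r + Num.sg s| + `|Num.sg s + Num.sg t| + `|Num.sg t + Num.sg r|.
Proof.
by case: (sgrP r) => // _ _; case: (sgrP s) => // _ _; case: (sgrP t) => // _ _;
  rewrite ?addrK ?subrr ?addNr ?subrK ?add0r ?addr0 ?normr0 ?normrN ?normr1
    -?opprD ?normrN ?addr0 ?add0r;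
  rewrite ?ger0_norm; lra.
Qed.

(** At a trivalent vertex the net total curvature is half the sum of the exterior
    angles of the three passages through the vertex: u and v point into their
    edges, so the passage from the first to the second edge turns from - u to v. *)
Lemma mean_trivalent u v w : u != 0 -> v != 0 -> w != 0 ->
  pi / 2 * mean (fun x : tR => `|sgn u x + sgn v x + sgn w x|) =
  (angle (- u) v + angle (- v) w + angle (- w) u) / 2.
Proof.
move=> u0 v0 w0.
have E p q : angle (- p) q = pi / 2 * mean (fun x : tR => `|sgn p x + sgn q x|).
  rewrite /angle -mulrA -(meanZ 2^-1); last first.
    by apply: bounded_mfun_norm; apply: bounded_mfunD; exact: bounded_mfun_sgn.
  congr (_ * mean _); apply/funext => x.
  by rewrite sgn_opp -opprD normrN mulrC.
have b p q : bounded_mfun (fun x : tR => `|sgn p x + sgn q x|).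
  by apply: bounded_mfun_norm; apply: bounded_mfunD; exact: bounded_mfun_sgn.
have b3 : bounded_mfun (fun x : tR => `|sgn u x + sgn v x + sgn w x|).
  by apply: bounded_mfun_norm; apply: bounded_mfunD; [apply: bounded_mfunD|];
    exact: bounded_mfun_sgn.
have bS : bounded_mfun (fun x : tR =>
    `|sgn u x + sgn v x| + `|sgn v x + sgn w x| + `|sgn w x + sgn u x|).
  by apply: bounded_mfunD => //; exact: bounded_mfunD.
have -> : (angle (- u) v + angle (- v) w + angle (- w) u) / 2 = pi / 2 * mean (fun x : tR =>
    2^-1 * (`|sgn u x + sgn v x| + `|sgn v x + sgn w x| + `|sgn w x + sgn u x|)).
  rewrite !E (meanZ _ bS) (meanD (bounded_mfunD (b u v) (b v w)) (b w u)) (meanD (b u v) (b v w)).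
  by ring.
congr (_ * _).
apply: (@eq_mean_generic _ _ [:: u; v; w]) => //=.
- exact: bounded_mfunZ.
- by rewrite u0 v0 w0.
move=> x /and4P[xu xv xw _].
by rewrite -(sgr_trivalent xu xv xw) mulrA mulVf ?mul1r.
Qed.

End ntc.

(** * The turning of an edge *)

Section chain.
Context {R : realType} {n : nat}.

Lemma turning_chain (a z : nat -> 'rV[R]_n) (K : nat -> R) (p : nat -> 'rV[R]_n) k :
  (forall j, (j <= k)%N -> turning (a j) (z j) (K j) (p j.+1 - p j)) ->
  turning (a 0%N) (z k)
    (\sum_(j < k.+1) K j + \sum_(j < k) angle (z j) (a j.+1)) (p k.+1 - p 0%N).
Proof.
elim: k => [|k IH] H.
  by rewrite big_ord1 big_ord0 addr0; exact: H.
have H1 := IH (fun j jk => H j (leqW jk)).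
have -> : p k.+2 - p 0%N = (p k.+1 - p 0%N) + (p k.+2 - p k.+1) by rewrite [RHS]addrC addrA subrK.
rewrite big_ord_recr [X in _ + X]big_ord_recr /=.
rewrite (_ : _ + _ = \sum_(j < k.+1) K j + \sum_(j < k) angle (z j) (a j.+1) +
  angle (z k) (a k.+1) + K k.+1); last by ring.
exact: turning_cat H1 (H k.+1 (leqnn _)).
Qed.

End chain.

Section edges.
Context {R : realType} {G : graph} {n : nat} (f : mapping R G n).

Definition edge_start (e : edge G) := unit_tangent (arc f e 0) 0.
Definition edge_end (e : edge G) := unit_tangent (arc f e (breaks f e)) 1.

Lemma edge_start_neq0 e : edge_start e != 0.
Proof.
rewrite -dot_eq0 unit_tangent_dot1 ?oner_neq0 //; last by rewrite in_itv /= lexx ler01.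
exact: arc_regular.
Qed.

Lemma edge_end_neq0 e : edge_end e != 0.
Proof.
rewrite -dot_eq0 unit_tangent_dot1 ?oner_neq0 //; last by rewrite in_itv /= lexx ler01.
exact: arc_regular.
Qed.

Lemma turning_edge (e : edge G) : exists2 K : R,
  (\sum_(i < breaks f e) ntc (joint_tangents f e i) +
   \sum_(i < (breaks f e).+1) arc_curvature (arc f e i))%E = K%:E &
  turning (edge_start e) (edge_end e) K (position f (tgt e) - position f (src e)).
Proof.
have /choice[K HK] : forall i : nat, exists K : R, (i <= breaks f e)%N ->
    arc_curvature (arc f e i) = K%:E /\
    turning (unit_tangent (arc f e i) 0) (unit_tangent (arc f e i) 1) K
      (arc f e i 1 - arc f e i 0).
  move=> i; have [ie|ie] := leqP i (breaks f e); last by exists 0.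
  by have [K KE tK] := turning_arc (arc_regular ie); exists K.
pose p (i : nat) := if i is j.+1 then arc f e j 1 else arc f e 0%N 0.
have := @turning_chain _ _ (fun i => unit_tangent (arc f e i) 0)
  (fun i => unit_tangent (arc f e i) 1) K p (breaks f e).
have -> : p (breaks f e).+1 - p 0%N = position f (tgt e) - position f (src e).
  by rewrite /= arc_tgt arc_src.
move=> H; eexists; last first.
  apply: H => j je; have [_] := HK j je.
  by case: j je => //= j je; rewrite -arc_joint.
rewrite EFinD [LHS]addeC; congr (_ + _)%E; rewrite -sumEFin; apply: eq_bigr => i _.
  by have [] := HK i (ltn_ord i : (i <= breaks f e)%N).
by rewrite /joint_tangents ntc_joint.
Qed.

(** An edge counts its arcs and its joints, hence the total curvature is a sum of
    vertex terms and of the curvatures of the edges. *)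
Lemma NTC_edges : exists2 K : edge G -> R,
  NTC f = (\sum_v pi / 2 * mean (fun x => `|total_sgn (vertex_tangents f v) x|) +
           \sum_e K e)%:E &
  forall e, turning (edge_start e) (edge_end e) (K e)
    (position f (tgt e) - position f (src e)).
Proof.
have /choice[K HK] : forall e, exists K : R,
  (\sum_(i < breaks f e) ntc (joint_tangents f e i) +
   \sum_(i < (breaks f e).+1) arc_curvature (arc f e i))%E = K%:E /\
  turning (edge_start e) (edge_end e) K (position f (tgt e) - position f (src e)).
  by move=> e; have [K] := turning_edge e; exists K.
exists K; last by move=> e; have [] := HK e.
rewrite /NTC -addeA -big_split /= EFinD -!sumEFin; congr (_ + _)%E.
  by apply: eq_bigr => v _; rewrite ntcE.
by apply: eq_bigr => e _; have [] := HK e.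
Qed.

End edges.

(** * The faces of the ladder *)

Section ladder.
Context {R : realType} {m n : nat} (f : mapping R (ladder m) n).
Notation mR := (measurableTypeR R).
Notation tR := (n.-tuple mR).

Let a b i := edge_start f (inl (b, i)).
Let z b i := edge_end f (inl (b, i)).
Let ra i := edge_start f (inr i).
Let rz i := edge_end f (inr i).
Let rung (b : bool) i := if b then - rz i else ra i.

(** At (b, i) meet the circle edge that leaves, the circle edge that arrives from
    the cyclic predecessor, and a rung. *)
Lemma total_sgn_ladder (b : bool) (i : 'I_m) (x : tR) :
  total_sgn (vertex_tangents f (b, i)) x =
  sgn (a b i) x + sgn (- z b (ord_pred i)) x + sgn (rung b i) x.
Proof.
rewrite /total_sgn /vertex_tangents big_cat !big_map !big_filter.
rewrite !big_enum_cond /= !big_sumType /=.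
have E1 (F : bool * 'I_m -> R) : \sum_(p : bool * 'I_m | p == (b, i)) F p = F (b, i).
  by rewrite big_pred1_eq.
have E2 (F : bool * 'I_m -> R) :
    \sum_(p : bool * 'I_m | (p.1, ordS p.2) == (b, i)) F p = F (b, ord_pred i).
  rewrite (big_pred1 (b, ord_pred i)) // => -[b' j] /=.
  rewrite !xpair_eqE; congr (_ && _); apply/eqP/eqP => [<-|->].
    by rewrite ordSK.
  by rewrite ord_predK.
rewrite E1 E2.
have E3 (b' : bool) (F : 'I_m -> R) :
    \sum_(j < m | (b', j) == (b, i)) F j = if b' == b then F i else 0.
  case: eqP => [->|bb]; last first.
    by rewrite big_pred0 // => j; rewrite xpair_eqE; case: eqP bb.
  by rewrite (big_pred1 i) // => j; rewrite xpair_eqE eqxx.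
rewrite !E3 /rung; case: b {E1 E2 E3}; rewrite /= !addr0; first by rewrite addrA.
exact: addrAC.
Qed.

Lemma mean_ladder_vertex (b : bool) (i : 'I_m) :
  pi / 2 * mean (fun x : tR => `|total_sgn (vertex_tangents f (b, i)) x|) =
  (angle (z b (ord_pred i)) (a b i) + angle (z b (ord_pred i)) (rung b i) +
   angle (- rung b i) (a b i)) / 2.
Proof.
under eq_fun do rewrite total_sgn_ladder.
have a0 : a b i != 0 by exact: edge_start_neq0.
have z0 : - z b (ord_pred i) != 0 by rewrite oppr_eq0; exact: edge_end_neq0.
have r0 : rung b i != 0.
  by rewrite /rung; case: b {a0 z0}; rewrite ?oppr_eq0;
    [exact: edge_end_neq0|exact: edge_start_neq0].
move: a0 z0 r0; move: (a b i) (z b (ord_pred i)) (rung b i) => u v w u0 v0 w0.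
by rewrite (mean_trivalent u0 v0 w0) angle_opp opprK (angle_sym u).
Qed.

Variable K : edge (ladder m) -> R.
Hypothesis tK : forall e, turning (edge_start f e) (edge_end f e) (K e)
  (position f (tgt e) - position f (src e)).

(** Run along the first circle, up the next rung, back along the second circle
    and down the rung. *)
Lemma quadrilateral_face (i : 'I_m) :
  2 * pi <= K (inl (false, i)) + angle (z false i) (ra (ordS i)) +
    K (inr (ordS i)) + angle (rz (ordS i)) (- z true i) +
    K (inl (true, i)) + angle (- a true i) (- rz i) + K (inr i) + angle (- ra i) (a false i).
Proof.
have t1 := tK (inl (false, i)).
have t2 := tK (inr (ordS i)).
have t3 := turning_rev (tK (inl (true, i))).
have t4 := turning_rev (tK (inr i)).
apply: fenchel; have := turning_cat (turning_cat (turning_cat t1 t2) t3) t4.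
congr turning; rewrite /=.
by apply/rowP => j; rewrite !mxE; ring.
Qed.

End ladder.

Lemma sum_cyclic (R : nmodType) (m : nat) (g : 'I_m.+1 -> 'I_m.+1 -> R) :
  \sum_(i < m.+1) g (ord_pred i) i =
  \sum_(j < m) g (inord j) (inord j.+1) + g (inord m) (inord 0).
Proof.
rewrite big_ord_recl addrC; congr (_ + _); last first.
  congr g; apply: val_inj; rewrite /= inordK //.
  by rewrite modn_small.
apply: eq_bigr => i _; congr g; apply: val_inj.
  have im : (i < m.+1)%N by rewrite ltnS ltnW.
  by rewrite /= inordK // -[RHS](modn_small im) -[RHS]modnDr.
by rewrite /= inordK // ltnS.
Qed.

Section circle_face.
Context {R : realType} {m n : nat} (f : mapping R (ladder m.+1) n).
Variable K : edge (ladder m.+1) -> R.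
Hypothesis tK : forall e, turning (edge_start f e) (edge_end f e) (K e)
  (position f (tgt e) - position f (src e)).

Let a b i := edge_start f (inl (b, i)).
Let z b i := edge_end f (inl (b, i)).

Lemma circle_face (b : bool) : 2 * pi <=
  \sum_(i < m.+1) K (inl (b, i)) + \sum_(i < m.+1) angle (z b (ord_pred i)) (a b i).
Proof.
pose p (k : nat) := position f (b, inord (k %% m.+1)).
have chain := @turning_chain _ _ (fun k => a b (inord k)) (fun k => z b (inord k))
  (fun k => K (inl (b, inord k))) p m.
have /chain T j : (j <= m)%N ->
    turning (a b (inord j)) (z b (inord j)) (K (inl (b, inord j))) (p j.+1 - p j).
  move=> jm; have := tK (inl (b, inord j));
  congr (turning _ _ _ (position f (_, _) - position f (_, _))).
    by apply: val_inj; rewrite /= !inordK // ltn_mod.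
  by rewrite modn_small.
have p0 : p m.+1 - p 0%N = 0 by rewrite /p modnn mod0n subrr.
rewrite p0 in T; have := fenchel T.
rewrite -addrA; congr (_ <= _ + _).
  by apply: eq_bigr => i _; rewrite inord_val.
exact/esym/(sum_cyclic (fun i j => angle (z b i) (a b j))).
Qed.

End circle_face.

(** Each edge lies on two of the m + 2 faces, and the three passages at a vertex
    belong to the three faces around it. So twice the net total curvature is the
    sum of the total curvatures of the faces. *)
Lemma NTC_ladder_ge (R : realType) (m n : nat) (f : mapping R (ladder m) n) :
  (0 < m)%N -> ((pi * (2 + m%:R))%:E <= NTC f)%E.
Proof.
case: m f => // m f _; have [K -> tK] := NTC_edges f.
rewrite lee_fin.
pose a b i := edge_start f (inl (b, i)).
pose z b i := edge_end f (inl (b, i)).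
pose ra i := edge_start f (inr i).
pose rz i := edge_end f (inr i).
pose A b := \sum_(i < m.+1) angle (z b (ord_pred i)) (a b i).
pose B1 := \sum_(i < m.+1) angle (z false (ord_pred i)) (ra i).
pose B2 := \sum_(i < m.+1) angle (- ra i) (a false i).
pose B3 := \sum_(i < m.+1) angle (z true (ord_pred i)) (- rz i).
pose B4 := \sum_(i < m.+1) angle (- a true i) (- rz i).
pose C b := \sum_(i < m.+1) K (inl (b, i)).
pose C' := \sum_(i < m.+1) K (inr i).
have circle b : 2 * pi <= C b + A b by exact: circle_face tK b.
have quad (i : 'I_m.+1) : 2 * pi <= K (inl (false, i)) + angle (z false i) (ra (ordS i)) +
    K (inr (ordS i)) + angle (rz (ordS i)) (- z true i) +
    K (inl (true, i)) + angle (- a true i) (- rz i) + K (inr i) + angle (- ra i) (a false i).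
  exact: quadrilateral_face tK i.
have vertexF (i : 'I_m.+1) :
    pi / 2 * mean (fun x => `|total_sgn (vertex_tangents f (false, i)) x|) =
    (angle (z false (ord_pred i)) (a false i) + angle (z false (ord_pred i)) (ra i) +
     angle (- ra i) (a false i)) / 2.
  exact: mean_ladder_vertex f false i.
have vertexT (i : 'I_m.+1) :
    pi / 2 * mean (fun x => `|total_sgn (vertex_tangents f (true, i)) x|) =
    (angle (z true (ord_pred i)) (a true i) + angle (z true (ord_pred i)) (- rz i) +
     angle (- - rz i) (a true i)) / 2.
  exact: mean_ladder_vertex f true i.
clearbody a z ra rz.
have quads : m.+1%:R * (2 * pi) <= C false + B1 + C' + B3 + C true + B4 + C' + B2.
  have S1 : B1 = \sum_(i < m.+1) angle (z false i) (ra (ordS i)).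
    by rewrite /B1 (reindex_inj (@ordS_inj _)); apply: eq_bigr => i _; rewrite ordSK.
  have S3 : B3 = \sum_(i < m.+1) angle (rz (ordS i)) (- z true i).
    rewrite /B3 (reindex_inj (@ordS_inj _)); apply: eq_bigr => i _.
    by rewrite ordSK -(angle_opp (z true i)) opprK angle_sym.
  have S' : \sum_(i < m.+1) K (inr (ordS i)) = C'.
    by rewrite /C' [RHS](reindex_inj (@ordS_inj _)).
  have -> : m.+1%:R * (2 * pi) = \sum_(i < m.+1) (2 * pi) :> R.
    by rewrite sumr_const card_ord mulr_natl.
  apply: le_trans (ler_sum _ (fun i _ => quad i)) _.
  by rewrite !big_split /= S' -S1 -S3 lexx.
have V : \sum_v pi / 2 * mean (fun x => `|total_sgn (vertex_tangents f v) x|) =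
    (A false + B1 + B2 + (A true + B3 + B4)) / 2.
  transitivity (\sum_(b : bool) \sum_(i < m.+1)
    pi / 2 * mean (fun x => `|total_sgn (vertex_tangents f (b, i)) x|)).
    by rewrite pair_bigA; apply: eq_bigr => -[].
  rewrite big_bool /= [LHS]addrC [RHS]mulrDl; congr (_ + _).
    by rewrite /A /B1 /B2 -!big_split mulr_suml; apply: eq_bigr => i _; exact: vertexF.
  rewrite /A /B3 /B4 -!big_split mulr_suml; apply: eq_bigr => i _.
  by rewrite vertexT opprK (angle_opp (a true i)) (angle_sym (a true i)).
have E : \sum_e K e = C false + C true + C'.
  rewrite big_sumType /=; congr (_ + _); rewrite addrC.
  transitivity (\sum_(b : bool) \sum_(i < m.+1) K (inl (b, i))); last by rewrite big_bool.
  by rewrite pair_bigA; apply: eq_bigr => -[].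
rewrite V E; have := circle false; have := circle true.
clearbody A B1 B2 B3 B4 C C'; lra.
Qed.

(** * A mapping into the line *)

Section segment.
Context {R : realType}.
Implicit Types p q t : R.

Definition segment p q (t : R) : 'rV[R]_1 := const_mx (p + t * (q - p)).

Lemma segment0 p q : segment p q 0 = const_mx p.
Proof. by rewrite /segment mul0r addr0. Qed.

Lemma segment1 p q : segment p q 1 = const_mx q.
Proof. by rewrite /segment mul1r addrC subrK. Qed.

Lemma derive_segment p q t :
  derivable (segment p q) t 1 /\ derive1 (segment p q) t = const_mx (q - p).
Proof.
apply: is_derive_rV => j; rewrite mxE.
rewrite [F in is_derive _ _ F _](_ : _ = cst p + id * cst (q - p)); last first.
  by apply/funext => x; rewrite /segment mxE.
have d := is_deriveD (is_derive_cst p t 1)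
  (is_deriveM (is_derive_id t 1) (is_derive_cst (q - p) t 1)).
apply: is_derive_eq d _.
by rewrite add0r scaler0 add0r /GRing.scale /= mulr1.
Qed.

Lemma derive1_segment p q : derive1 (segment p q) = fun=> const_mx (q - p).
Proof. by apply/funext => t; have [] := derive_segment p q t. Qed.

Lemma segment_regular p q : p != q -> regular_C2_arc (segment p q).
Proof.
move=> pq; split.
- by move=> t; have [] := derive_segment p q t.
- by move=> t; rewrite derive1_segment; exact: derivable_cst.
- rewrite derive1_segment [X in continuous X](_ : _ = fun=> 0).
    exact: cst_continuous.
  by apply/funext => t; exact: derive1_cst.
- move=> t _; rewrite derive1_segment; apply/eqP => /rowP /(_ 0).
  by rewrite !mxE => /eqP; rewrite subr_eq0 eq_sym; exact/negP.
Qed.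

Lemma dot_row1 (u v : 'rV[R]_1) : dot u v = u 0 0 * v 0 0.
Proof. by rewrite /dot big_ord1. Qed.

Lemma segment_tangent p q t : unit_tangent (segment p q) t = const_mx (Num.sg (q - p)).
Proof.
rewrite /unit_tangent derive1_segment /direction; apply/rowP => j; rewrite !mxE.
rewrite /enorm dot_row1 !mxE -expr2 sqrtr_sqr.
have [->|qp] := eqVneq (q - p) 0; first by rewrite sgr0 mulr0.
by rewrite [X in _ * X]numEsg mulrCA mulVf ?mulr1 // normr_eq0.
Qed.

Lemma segment_curvature p q : arc_curvature (segment p q) = 0%E.
Proof.
rewrite /arc_curvature (eq_integral (cst 0%E)) ?integral0 // => t _ /=.
rewrite /curvature_vector (_ : unit_tangent _ = fun=> const_mx (Num.sg (q - p))).
  by rewrite derive1_cst scaler0 /enorm dot0l sqrtr0 mul0r.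
by apply/funext => s; exact: segment_tangent.
Qed.

(** In the line, almost every linear form agrees up to sign with the coordinate. *)
Lemma ntc_line (Ts : seq 'rV[R]_1) :
  ntc Ts = (pi / 2 * `|\sum_(T <- Ts) Num.sg (T 0 0)|)%:E.
Proof.
rewrite ntcE; congr (_ * _)%:E.
set S := `|_|.
rewrite -[RHS](@mean_cst R 1 S); apply: (@eq_mean_generic _ _ [:: const_mx 1]).
- exact/bounded_mfun_norm/bounded_mfun_total_sgn.
- exact: bounded_mfun_cst.
- rewrite /= andbT; apply/eqP => /rowP /(_ 0); rewrite !mxE => /eqP.
  by rewrite oner_eq0.
move=> x /andP[]; rewrite dot_row1 [const_mx 1 _ _]mxE mulr1 => x0 _.
rewrite /total_sgn /sgn.
under eq_bigr do rewrite dot_row1 sgrM.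
by rewrite -mulr_sumr normrM normr_sg x0 mul1r.
Qed.

End segment.

Section flat_ladder.
Context {R : realType} (m : nat).
Notation L := (ladder m.+1).

(** Both circles ascend in the order of their vertices and the second one lies
    above the first. In each circle the edge that closes it is broken in one
    point: it passes below everything on the first circle and above everything
    on the second one. Then every vertex has tangents of both directions, and
    the only other critical points are these two breaks. *)
Definition height (v : vertex L) : R := (v.1 * m.+1 + v.2)%:R.

Definition turn_height (b : bool) : R := if b then (2 * m.+1)%:R else -1.

Definition flat_breaks (e : edge L) : nat :=
  if e is inl (_, i) then (i == ord_max) : nat else 0.

Definition flat_arc (e : edge L) (k : nat) : R -> 'rV[R]_1 :=
  match e with
  | inl (b, i) =>
      if i == ord_max then
        if k is 0%N then segment (height (b, i)) (turn_height b)
        else segment (turn_height b) (height (b, ord0))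
      else segment (height (b, i)) (height (b, ordS i))
  | inr i => segment (height (false, i)) (height (true, i))
  end.

Lemma ordS_max : ordS (@ord_max m) = ord0.
Proof. by apply: val_inj; rewrite /= modnn. Qed.

Lemma ordS_val (i : 'I_m.+1) : i != ord_max -> ordS i = i.+1 :> nat.
Proof.
move=> im; rewrite /= modn_small // ltnS ltn_neqAle -ltnS ltn_ord andbT.
by apply: contra im => /eqP im; apply/eqP/val_inj.
Qed.

Lemma height_step (b : bool) (i : 'I_m.+1) : i != ord_max ->
  height (b, i) < height (b, ordS i).
Proof. by move=> im; rewrite /height ltr_nat ltn_add2l (ordS_val im). Qed.

Lemma height_rung (i : 'I_m.+1) : height (false, i) < height (true, i).
Proof. by rewrite /height /= ltr_nat mul0n add0n mul1n ltn_addr // ltn_ord. Qed.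

Lemma height_turn (i : 'I_m.+1) :
  turn_height false < height (false, i) /\ height (true, i) < turn_height true.
Proof.
split; first by rewrite /turn_height /height (lt_le_trans (ltrN10 _)) ?ler0n.
by rewrite /turn_height /height /= mul1n ltr_nat mul2n -addnn ltn_add2l ltn_ord.
Qed.

Lemma flat_regular e k : (k <= flat_breaks e)%N -> regular_C2_arc (flat_arc e k).
Proof.
case: e => [[b i]|i] /=; last first.
  by move=> _; apply: segment_regular; rewrite lt_eqF // height_rung.
have [h1 h2] := height_turn i; have [h3 h4] := height_turn ord0.
case: ifPn => im _; last by apply: segment_regular; rewrite lt_eqF // height_step.
case: b k => -[|k]; apply: segment_regular.
- by rewrite lt_eqF.
- by rewrite gt_eqF.
- by rewrite gt_eqF.
- by rewrite lt_eqF.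
Qed.

Lemma flat_src e : flat_arc e 0 0 = const_mx (height (src e)).
Proof.
by case: e => [[b i]|i] /=; [case: ifP => _|]; rewrite segment0.
Qed.

Lemma flat_tgt e : flat_arc e (flat_breaks e) 1 = const_mx (height (tgt e)).
Proof.
case: e => [[b i]|i] /=; last by rewrite segment1.
by case: eqP => [->|_]; rewrite /= segment1 // ordS_max.
Qed.

Lemma flat_joint e k : (k < flat_breaks e)%N -> flat_arc e k 1 = flat_arc e k.+1 0.
Proof.
case: e => [[b i]|i] //=; case: ifP => // _.
by case: k => // _; rewrite segment1 segment0.
Qed.

Definition flat_ladder : mapping R L 1 := @Mapping R L 1 (fun v => const_mx (height v))
  flat_breaks flat_arc flat_regular flat_src flat_tgt flat_joint.

Lemma flat_start (e : edge L) : edge_start flat_ladder e 0 0 =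
  if e is inl (b, i) then (if (i == ord_max) && ~~ b then -1 else 1) else 1.
Proof.
rewrite /edge_start /=; case: e => [[b i]|i] /=; last first.
  by rewrite segment_tangent mxE gtr0_sg // subr_gt0 height_rung.
have [h1 h2] := height_turn i.
case: ifPn => im /=; last by rewrite segment_tangent mxE gtr0_sg // subr_gt0 height_step.
rewrite segment_tangent mxE; case: b => /=; first by rewrite gtr0_sg // subr_gt0.
by rewrite ltr0_sg // subr_lt0.
Qed.

Lemma flat_end (e : edge L) : edge_end flat_ladder e 0 0 =
  if e is inl (b, i) then (if (i == ord_max) && b then -1 else 1) else 1.
Proof.
rewrite /edge_end /=; case: e => [[b i]|i] /=; last first.
  by rewrite segment_tangent mxE gtr0_sg // subr_gt0 height_rung.
have [h1 h2] := height_turn ord0.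
have [im|im] := eqVneq i ord_max; last first.
  by rewrite /= segment_tangent mxE gtr0_sg // subr_gt0 height_step.
rewrite /= segment_tangent mxE; case: b => /=; first by rewrite ltr0_sg // subr_lt0.
by rewrite gtr0_sg // subr_gt0.
Qed.

(** On the first circle the arriving edge ascends and so does the rung, which
    cancel; on the second circle the leaving edge ascends and the rung descends,
    which cancel too. The remaining sign makes the sum equal to 1 or -1. *)
Lemma ntc_flat_vertex (v : vertex L) : ntc (vertex_tangents flat_ladder v) = (pi / 2)%:E.
Proof.
case: v => b i.
rewrite ntcE -[RHS]/(pi / 2)%:E; congr (_%:E); rewrite -[RHS]mulr1; congr (_ * _).
rewrite -[RHS](@mean_cst R 1 1); apply: (@eq_mean_generic _ _ [:: const_mx 1]).
- exact/bounded_mfun_norm/bounded_mfun_total_sgn.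
- exact: bounded_mfun_cst.
- rewrite /= andbT; apply/eqP => /rowP /(_ 0); rewrite !mxE => /eqP.
  by rewrite oner_eq0.
move=> x /andP[]; rewrite dot_row1 [const_mx 1 _ _]mxE mulr1 => x0 _.
have E (w : 'rV[R]_1) : sgn w x = Num.sg (vec_of_tuple x 0 0) * Num.sg (w 0 0).
  by rewrite /sgn dot_row1 sgrM.
rewrite total_sgn_ladder !E -!mulrDr normrM normr_sg x0 mul1r.
have oppE (w : 'rV[R]_1) : (- w) 0 0 = - w 0 0 by rewrite mxE.
have rungE : (if b then - edge_end flat_ladder (inr i) else edge_start flat_ladder (inr i)) 0 0 =
    if b then -1 else 1.
  case: (b); last exact: flat_start (inr i).
  by apply: etrans (oppE _) _; congr (- _); exact: flat_end (inr i).
rewrite (oppE (edge_end _ _)).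
have sum1 (r s t : R) : s = (if (i == ord_max) && ~~ b then -1 else 1) ->
    t = (if (ord_pred i == ord_max) && b then -1 else 1) -> r = (if b then -1 else 1) ->
    `|Num.sg s + Num.sg (- t) + Num.sg r| = 1.
  move=> -> -> ->; case: (b); rewrite ?(andbT, andbF) /= ?(andbT, andbF);
    case: ifP => _; rewrite !(sgrN, sgr1); case: ler0P => *; lra.
exact: sum1 (flat_start (inl (b, i))) (flat_end (inl (b, ord_pred i))) rungE.
Qed.

Lemma NTC_flat_ladder : NTC flat_ladder = (pi * (2 + m.+1%:R))%:E.
Proof.
rewrite /NTC.
have -> : (\sum_v ntc (vertex_tangents flat_ladder v) = (pi * m.+1%:R)%:E)%E.
  under eq_bigr do rewrite ntc_flat_vertex.
  rewrite sumEFin sumr_const card_prod card_bool card_ord -[LHS]/((pi / 2 *+ _)%:E).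
  rewrite -mulr_natr natrM.
  by congr (_%:E); field.
have -> : (\sum_e \sum_(i < (breaks flat_ladder e).+1) arc_curvature (arc flat_ladder e i) = 0)%E.
  apply: big1 => -[[b i]|i] _; apply: big1 => k _ /=; last exact: segment_curvature.
  case: ifP => _; last exact: segment_curvature.
  by case: (k : nat) => [|j]; exact: segment_curvature.
rewrite adde0.
have -> : (\sum_e \sum_(i < breaks flat_ladder e) ntc (joint_tangents flat_ladder e i) =
    (2 * pi)%:E)%E.
  rewrite big_sumType /= [X in (_ + X)%E]big1 ?adde0; last by move=> i _; rewrite big_ord0.
  transitivity (\sum_(b : bool) \sum_(i < m.+1) (if i == ord_max then pi%:E else 0%E : \bar R))%E.
    rewrite pair_bigA; apply: eq_bigr => -[b i] _ /=.
    case: eqP => im /=; last by rewrite big_ord0.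
    rewrite big_ord1 ntc_line /joint_tangents /= im eqxx !segment_tangent.
    rewrite !big_cons big_nil !mxE.
    have [h1 h2] := height_turn ord0.
    have [h3 h4] := height_turn ord_max.
    have up (p q : R) : p < q -> Num.sg (q - p) = 1 by move=> pq; rewrite gtr0_sg ?subr_gt0.
    have down (p q : R) : q < p -> Num.sg (q - p) = -1 by move=> pq; rewrite ltr0_sg ?subr_lt0.
    case: (b) => /=.
      rewrite (up _ _ h4) (down _ _ h2) !(sgrN, sgr1) ler0_norm; last by lra.
      by congr (_%:E); field.
    rewrite (up _ _ h1) (down _ _ h3) !(sgrN, sgr1) ger0_norm; last by lra.
    by congr (_%:E); field.
  under eq_bigr do rewrite -big_mkcond big_pred1_eq.
  by rewrite big_bool /= -EFinD; congr (_%:E); ring.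
by rewrite -EFinD; congr (_%:E); ring.
Qed.

End flat_ladder.

Theorem corollary11 (R : realType) (m : nat) (hm : (1 <= m)%N) :
  min_NTC R (ladder m) = (pi * (2 + m%:R))%:E.
Proof.
apply/eqP; rewrite eq_le; apply/andP; split; last first.
  apply: le_ereal_inf_tmp => _ [n [f n0 ->]]; exact: NTC_ladder_ge.
case: m hm => // m _; rewrite -NTC_flat_ladder; apply: ereal_inf_lbound.
by exists 1%N, (@flat_ladder R m).
Qed.
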